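(* Let $m,n\ge 1$ be integers. The group $B_{m,n}\le B_{m+n}$ has a presentation with generators the braids $a_{1,m+1},a_{2,m+1},\ldots,a_{m,m+1}$ together with $\sigma_{m+1},\sigma_{m+2},\ldots,\sigma_{m+n-1}$, and defining relations the following, for all indices such that every symbol occurring is one of these generators, and for $\varepsilon\in\{+1,-1\}$: \begin{align*} (\Sigma_1)\quad & \sigma_k\sigma_l=\sigma_l\sigma_k && \text{if } |k-l|>1,\\ (\Sigma_2)\quad & \sigma_k\sigma_{k+1}\sigma_k=\sigma_{k+1}\sigma_k\sigma_{k+1} && \text{if } m+1\le k\le m+n-2,\\ (1')\quad & \sigma_k^{-1}a_{i,m+1}^{\varepsilon}\sigma_k=a_{i,m+1}^{\varepsilon} && \text{if } k\ge m+2,\\ (2')\quad & a_{i,m+1}^{\varepsilon}\,\sigma_{m+1}a_{i,m+1}\sigma_{m+1}=\sigma_{m+1}a_{i,m+1}\sigma_{m+1}\,a_{i,m+1}^{\varepsilon}, &&\\ (3')\quad & a_{i,m+1}^{\varepsilon}\,(\sigma_{m+1}a_{r,m+1}^{\varepsilon}\sigma_{m+1}^{-1})=(\sigma_{m+1}a_{r,m+1}^{\varepsilon}\sigma_{m+1}^{-1})\,a_{i,m+1}^{\varepsilon} && \text{if } r<i. \end{align*}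
   Context: $B_k$ denotes the classical Artin braid group on $k$ strands, with standard generators $\sigma_1,\ldots,\sigma_{k-1}$, relations $\sigma_i\sigma_j=\sigma_j\sigma_i$ for $|i-j|>1$ and $\sigma_i\sigma_{i+1}\sigma_i=\sigma_{i+1}\sigma_i\sigma_{i+1}$, and product given by concatenation. $B_{m,n}\le B_{m+n}$ is the subgroup of all braids on $m+n$ strands such that, if the last $n$ strands are removed, what is left is the identity braid on the first $m$ strands (in particular the first $m$ strands begin and end at the positions $1,\ldots,m$, strand $i$ ending at position $i$). For $1\le i<j\le m+n$, the element $a_{ij}\in B_{m+n}$ is $$a_{ij}=\sigma_i^{-1}\sigma_{i+1}^{-1}\cdots\sigma_{j-2}^{-1}\,\sigma_{j-1}^{2}\,\sigma_{j-2}\cdots\sigma_{i+1}\sigma_i=\sigma_{j-1}\sigma_{j-2}\cdots\sigma_{i+1}\,\sigma_i^{2}\,\sigma_{i+1}^{-1}\cdots\sigma_{j-2}^{-1}\sigma_{j-1}^{-1}.$$ *)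

(* Defs.v *)
From HB Require Import structures.
From mathcomp Require Import all_boot.
From mathcomp Require Import boolp classical_sets.
From mathcomp Require Import zify.

Set Implicit Arguments.
Unset Strict Implicit.
Unset Printing Implicit Defensive.

Import Algebra.
Local Open Scope quotient_scope.
Local Open Scope group_scope.
Local Open Scope nat_scope.

(* The letter (x, false) is the generator x, the letter (x, true) its
   inverse. *)
Definition word (X : Type) := seq (X * bool).

Definition letter (X : Type) (x : X) (e : bool) : word X := [:: (x, e)].

Definition winv (X : Type) (w : word X) : word X :=
  rev [seq (a.1, ~~ a.2) | a <- w].

(* The congruence on words generated by free cancellation and by the
   relations r = s for R r s. *)
Inductive pres_eq (X : Type) (R : word X -> word X -> Prop) :
    word X -> word X -> Prop :=
| pres_refl u : pres_eq R u u
| pres_sym u v : pres_eq R u v -> pres_eq R v u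
| pres_trans v u w : pres_eq R u v -> pres_eq R v w -> pres_eq R u w
| pres_cancel u x e v : pres_eq R (u ++ (x, e) :: (x, ~~ e) :: v) (u ++ v)
| pres_rel u r s v : R r s -> pres_eq R (u ++ r ++ v) (u ++ s ++ v).

Section PresentedGroup.
Variables (X : choiceType) (R : word X -> word X -> Prop).
Implicit Types u v w : word X.

Let eqR : rel (word X) := fun u v => `[< pres_eq R u v >].

Fact pres_equiv_class : equiv_class_of eqR.
Proof.
split=> [u|u v|v u w].
- by apply/asboolP; exact: pres_refl.
- by apply/asboolP/asboolP => /pres_sym.
- by move=> /asboolP uv /asboolP vw; apply/asboolP; exact: pres_trans uv vw.
Qed.

Canonical pres_equiv := EquivRelPack pres_equiv_class.

Definition pgroup := {eq_quot pres_equiv}.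

HB.instance Definition _ := Choice.on pgroup.
HB.instance Definition _ : EqQuotient _ pres_equiv pgroup :=
  EqQuotient.on pgroup.

Definition wclass (w : word X) : pgroup := \pi_pgroup w.

Lemma wclassP u v : wclass u = wclass v <-> pres_eq R u v.
Proof.
split=> [/eqquotP/asboolP //|uv]; by apply/eqquotP/asboolP.
Qed.

Lemma wclass_rel u v : R u v -> wclass u = wclass v.
Proof.
move=> uv; apply/wclassP; rewrite -[u]cats0 -[v]cats0.
exact: (@pres_rel _ _ [::] u v [::]).
Qed.

Lemma wclass_repr (g : pgroup) : wclass (repr g) = g.
Proof. exact: reprK. Qed.

Lemma pres_eq_cat u u' v v' :
  pres_eq R u u' -> pres_eq R v v' -> pres_eq R (u ++ v) (u' ++ v').
Proof.
move=> uu' vv'; apply: (@pres_trans _ _ (u ++ v')).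
- elim: vv' => {v v'} [v|v w _|w v x _ + _|a x e b|a r s b rs].
  + exact: pres_refl.
  + exact: pres_sym.
  + exact: pres_trans.
  + by rewrite !catA; exact: pres_cancel.
  + by rewrite 2!(catA u a); exact: pres_rel.
- elim: uu' => {u u'} [u|u w _|w u x _ + _|a x e b|a r s b rs].
  + exact: pres_refl.
  + exact: pres_sym.
  + exact: pres_trans.
  + by rewrite -!catA /=; exact: pres_cancel.
  + by rewrite -!catA; exact: pres_rel.
Qed.

Lemma winvK w : winv (winv w) = w.
Proof.
rewrite /winv map_rev revK -map_comp map_id_in // => -[x e] _ /=.
by rewrite negbK.
Qed.

Lemma winv_cat u v : winv (u ++ v) = winv v ++ winv u.
Proof. by rewrite /winv map_cat rev_cat. Qed.

Lemma pres_catV w : pres_eq R (w ++ winv w) [::].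
Proof.
elim: w => [|[x e] w IH]; first exact: pres_refl.
rewrite -cat1s winv_cat -catA [w ++ _]catA.
apply: (@pres_trans _ _ ([:: (x, e)] ++ [::] ++ winv [:: (x, e)])).
  apply: pres_eq_cat; first exact: pres_refl.
  by apply: pres_eq_cat; [exact: IH | exact: pres_refl].
exact: (@pres_cancel _ _ [::] x e [::]).
Qed.

Lemma pres_Vcat w : pres_eq R (winv w ++ w) [::].
Proof. by have := pres_catV (winv w); rewrite winvK. Qed.

Lemma pres_eq_inv u v : pres_eq R u v -> pres_eq R (winv u) (winv v).
Proof.
move=> uv.
apply: (@pres_trans _ _ (winv u ++ (v ++ winv v))).
  rewrite -[X in pres_eq R X _]cats0; apply: pres_eq_cat.
    exact: pres_refl.
  exact/pres_sym/pres_catV.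
rewrite catA -[X in pres_eq R _ X]cat0s.
apply: pres_eq_cat; last exact: pres_refl.
apply: (@pres_trans _ _ (winv u ++ u)); last exact: pres_Vcat.
by apply: pres_eq_cat; [exact: pres_refl | exact: pres_sym].
Qed.

Definition pmul : pgroup -> pgroup -> pgroup :=
  locked (fun g h => wclass (repr g ++ repr h)).
Definition pone : pgroup := wclass [::].
Definition pinv : pgroup -> pgroup :=
  locked (fun g => wclass (winv (repr g))).

Lemma repr_wclass w : pres_eq R (repr (wclass w)) w.
Proof. by apply/wclassP; rewrite wclass_repr. Qed.

Lemma pmulE u v : pmul (wclass u) (wclass v) = wclass (u ++ v).
Proof. by rewrite /pmul -lock; apply/wclassP; apply: pres_eq_cat; exact: repr_wclass. Qed.

Lemma pinvE u : pinv (wclass u) = wclass (winv u).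
Proof. by rewrite /pinv -lock; apply/wclassP/pres_eq_inv/repr_wclass. Qed.

Fact pmulA : associative pmul.
Proof.
move=> g h k; rewrite -[g]wclass_repr -[h]wclass_repr -[k]wclass_repr.
by rewrite !pmulE catA.
Qed.

Fact pmul1g : left_id pone pmul.
Proof. by move=> g; rewrite -[g]wclass_repr pmulE. Qed.

Fact pmulg1 : right_id pone pmul.
Proof. by move=> g; rewrite -[g]wclass_repr pmulE cats0. Qed.

Fact pmulVg : left_inverse pone pinv pmul.
Proof.
by move=> g; rewrite -[g]wclass_repr pinvE pmulE; apply/wclassP/pres_Vcat.
Qed.

Fact pmulgV : right_inverse pone pinv pmul.
Proof.
by move=> g; rewrite -[g]wclass_repr pinvE pmulE; apply/wclassP/pres_catV.
Qed.

HB.instance Definition _ := isGroup.Build pgroup pmulA pmul1g pmulg1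
  pmulVg pmulgV.

Definition pgen (x : X) : pgroup := wclass (letter x false).

Lemma wclass_cat u v : wclass (u ++ v) = (wclass u * wclass v)%g.
Proof. by rewrite -[RHS]/(pmul _ _) pmulE. Qed.

Lemma wclass_inv u : wclass (winv u) = ((wclass u)^-1)%g.
Proof. by rewrite -[RHS]/(pinv _) pinvE. Qed.

End PresentedGroup.

(* The subgroup H of G is presented by the generators f x (x : X), subject to
   the defining relations R. *)
Definition has_presentation (G : groupType) (H : set G) (X : choiceType)
    (f : X -> G) (R : word X -> word X -> Prop) : Prop :=
  exists phi : {multiplicative pgroup R -> G},
    [/\ forall x, phi (pgen R x) = f x, injective phi & range phi = H].

Definition index_range (a b : nat) := {k : nat | a <= k < b}.

Inductive artin_rel (k : nat) :
    word (index_range 1 k) -> word (index_range 1 k) -> Prop :=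
| artin_comm (i j : index_range 1 k) :
    (val i).+1 < val j \/ (val j).+1 < val i ->
    artin_rel (letter i false ++ letter j false)
              (letter j false ++ letter i false)
| artin_braid (i j : index_range 1 k) :
    val j = (val i).+1 ->
    artin_rel (letter i false ++ letter j false ++ letter i false)
              (letter j false ++ letter i false ++ letter j false).

Definition braid (k : nat) := pgroup (@artin_rel k).
HB.instance Definition _ k := Group.on (braid k).
HB.instance Definition _ k : EqQuotient _ (pres_equiv (@artin_rel k)) (braid k) :=
  EqQuotient.on (braid k).

(* Total in i; the value 1 outside 1 <= i < k is junk. *)
Definition sigma (k i : nat) : braid k :=
  if insub i is Some x then pgen (@artin_rel k) x else 1%g.

(* a_ij = (sigma_i^-1 ... sigma_(j-2)^-1) sigma_(j-1)^2 (sigma_(j-2) ... sigma_i);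
   pure_genE below is the other usual expression. *)
Definition pure_gen (k i j : nat) : braid k :=
  ((\prod_(i <= t < j.-1) (sigma k t)^-1) * sigma k j.-1 ^+ 2
   * \prod_(t <- rev (index_iota i j.-1)) sigma k t)%g.

(* The effect of a crossing at positions i, i+1 on the positions. *)
Definition cross (i x : nat) : nat :=
  if x == i then i.+1 else if x == i.+1 then i else x.

(* The final position of the strand of w starting at position x. *)
Definition strand_end_word k (w : word (index_range 1 k)) (x : nat) : nat :=
  foldl (fun y a => cross (val a.1) y) x w.

Definition kept (p : pred nat) (i : nat) : nat := count p (iota 1 i).

(* The braid on m strands left from w when only the strands starting at the
   positions in keep are kept (keep should hold for m of the positions
   1, ..., k).  A crossing survives iff both of its strands are kept, and its
   index becomes the rank of its left position among the kept positions. *)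
Fixpoint keep_strands_word k m (keep : pred nat) (w : word (index_range 1 k)) :
    braid m :=
  if w is (i, e) :: w' then
    let s := sigma m (kept keep (val i)) in
    ((if keep (val i) && keep (val i).+1 then if e then s^-1 else s else 1)
     * keep_strands_word m (keep \o cross (val i)) w')%g
  else 1%g.

(* Both notions depend only on the braid, not on the word chosen by repr:
   see strand_endE and remove_lastE. *)
Definition strand_end k (b : braid k) (x : nat) : nat :=
  strand_end_word (repr b) x.

Definition remove_last m n (b : braid (m + n)) : braid m :=
  keep_strands_word m (fun x => x <= m) (repr b).

(* The first condition is part of "the first m strands are left fixed": for
   instance sigma_1 in B_(1+1) leaves the trivial braid on one strand, but it
   moves that strand. *)
Definition mixed_braid (m n : nat) : set (braid (m + n)) :=
  [set b | (forall i, 1 <= i <= m -> strand_end b i = i)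
           /\ remove_last b = 1%g].
Arguments mixed_braid : clear implicits.

(* inl i stands for a_(i,m+1), and inr k for sigma_k. *)
Definition mixed_index (m n : nat) : choiceType :=
  (index_range 1 m.+1 + index_range m.+1 (m + n))%type.

Definition mixed_gen (m n : nat) (x : mixed_index m n) : braid (m + n) :=
  match x with
  | inl i => pure_gen (m + n) (val i) m.+1
  | inr k => sigma (m + n) (val k)
  end.

Section MixedRel.
Variables m n : nat.

Let s (k : index_range m.+1 (m + n)) : word (mixed_index m n) :=
  letter (inr k) false.
Let sV (k : index_range m.+1 (m + n)) : word (mixed_index m n) :=
  letter (inr k) true.
Let a (i : index_range 1 m.+1) (e : bool) : word (mixed_index m n) :=
  letter (inl i) e.

(* The exponent epsilon is +1 for e = false, and -1 for e = true. *)
Inductive mixed_rel : word (mixed_index m n) -> word (mixed_index m n) -> Prop :=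
| mixed_sigma_comm k l : (val k).+1 < val l \/ (val l).+1 < val k ->
    mixed_rel (s k ++ s l) (s l ++ s k)
| mixed_sigma_braid k l : val l = (val k).+1 ->
    mixed_rel (s k ++ s l ++ s k) (s l ++ s k ++ s l)
| mixed_conj i k e : m.+2 <= val k ->
    mixed_rel (sV k ++ a i e ++ s k) (a i e)
| mixed_four i k e : val k = m.+1 ->
    mixed_rel (a i e ++ s k ++ a i false ++ s k)
              (s k ++ a i false ++ s k ++ a i e)
| mixed_slide i r k e : val k = m.+1 -> val r < val i ->
    mixed_rel (a i e ++ (s k ++ a r e ++ sV k))
              ((s k ++ a r e ++ sV k) ++ a i e).

End MixedRel.

Section WellDefined.
Variables (k m : nat).
Implicit Types (u v w : word (index_range 1 k)) (p : pred nat).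

Ltac cross_lia := rewrite /cross;
  repeat match goal with |- context [@eq_op _ ?x ?y] =>
    lazymatch x with
    | context [if _ then _ else _] => fail
    | _ => case: (@eqP _ x y) => ?
    end end; lia.

Lemma crossK i : involutive (cross i).
Proof. by move=> x; cross_lia. Qed.

Lemma cross_far i j x : i.+1 < j -> cross i (cross j x) = cross j (cross i x).
Proof. by move=> ?; cross_lia. Qed.

Lemma cross_braid i x :
  cross i (cross i.+1 (cross i x)) = cross i.+1 (cross i (cross i.+1 x)).
Proof. by cross_lia. Qed.

Lemma keptS p i : kept p i.+1 = kept p i + p i.+1.
Proof. by rewrite /kept -(addn1 i) iotaD count_cat /= addn0 (addnC 1). Qed.

Lemma cross_id i x : x != i -> x != i.+1 -> cross i x = x.
Proof. by rewrite /cross => /negbTE-> /negbTE->. Qed.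

Lemma cross_l i : cross i i = i.+1.
Proof. by rewrite /cross eqxx. Qed.

Lemma cross_r i : cross i i.+1 = i.
Proof. by rewrite /cross eqxx gtn_eqF. Qed.

Lemma kept_lt p i j : j < i -> kept (p \o cross i) j = kept p j.
Proof.
elim: j => [//|j IH] ji; rewrite !keptS IH /= ?cross_id //; lia.
Qed.

Lemma kept_mid p i : 0 < i -> kept (p \o cross i) i + p i = kept p i + p i.+1.
Proof. by case: i => // i _; rewrite !keptS kept_lt //= cross_l; lia. Qed.

Lemma kept_gt p i j : 0 < i < j -> kept (p \o cross i) j = kept p j.
Proof.
move=> /andP[i0]; elim: j => [//|j IH] ij.
have [->|ij'] := eqVneq j i.
  by rewrite !keptS /= cross_r kept_mid.
rewrite !keptS IH /= ?cross_id //; lia.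
Qed.

Lemma kept_le p i j : i <= j -> kept p i <= kept p j.
Proof.
elim: j => [|j IH]; first by case: i.
by rewrite leq_eqVlt => /orP[/eqP->//|/IH]; rewrite keptS; lia.
Qed.

Lemma comp_crossK p i : (p \o cross i) \o cross i = p.
Proof. by apply/funext => x /=; rewrite crossK. Qed.

Definition keep_after p w : pred nat :=
  foldl (fun q a => q \o cross (val a.1)) p w.

Lemma keep_strands_cat p u v :
  keep_strands_word m p (u ++ v) =
  (keep_strands_word m p u * keep_strands_word m (keep_after p u) v)%g.
Proof.
by elim: u p => [|[i e] u IH] p /=; rewrite ?mul1g // IH mulgA.
Qed.

Lemma kept_after p w : kept (keep_after p w) k = kept p k.
Proof.
elim: w p => [//|[i e] w IH] p /=; rewrite IH kept_gt //.
by case: i => i /= ->.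
Qed.

Lemma strand_end_cat u v x :
  strand_end_word (u ++ v) x = strand_end_word v (strand_end_word u x).
Proof. by rewrite /strand_end_word foldl_cat. Qed.

Lemma sigma_comm i j :
  i.+1 < j -> (sigma m i * sigma m j = sigma m j * sigma m i)%g.
Proof.
move=> ij; rewrite /sigma.
case: insubP => [x _ xi|_]; last by rewrite mul1g mulg1.
case: insubP => [y _ yj|_]; last by rewrite mul1g mulg1.
rewrite /pgen -!wclass_cat; apply: wclass_rel.
by apply: artin_comm; rewrite xi yj; left.
Qed.

Lemma sigma_braid i : 0 < i -> i.+1 < m ->
  (sigma m i * (sigma m i.+1 * sigma m i) =
   sigma m i.+1 * (sigma m i * sigma m i.+1))%g.
Proof.
move=> i0 im; rewrite /sigma.
case: insubP => [x _ xi|]; last by lia.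
case: insubP => [y _ yj|]; last by lia.
rewrite /pgen -!wclass_cat; apply: wclass_rel.
by apply: artin_braid; rewrite xi yj.
Qed.

Definition keep_eq u v := forall p, kept p k <= m ->
  keep_after p u = keep_after p v
  /\ keep_strands_word m p u = keep_strands_word m p v.

Lemma keep_eq_ctx u r s v : keep_eq r s -> keep_eq (u ++ r ++ v) (u ++ s ++ v).
Proof.
move=> rs p pm; rewrite !keep_strands_cat /keep_after !foldl_cat.
have [] := rs (keep_after p u); first by rewrite kept_after.
by rewrite /keep_after => -> ->.
Qed.

Lemma keep_eq_cancel x e : keep_eq [:: (x, e); (x, ~~ e)] [::].
Proof.
case: x => i ix p _; have /andP[i0 ik] := ix; split; first exact: comp_crossK.
rewrite /= cross_l cross_r andbC mulg1.
have := kept_mid p i0.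
case: (p i) => [] //=; case: (p i.+1) => [] //=; rewrite ?mulg1 //.
move=> /addIn ->; by case: e; rewrite /= ?mulVg ?mulgV.
Qed.

Lemma keep_eq_artin r s : artin_rel r s -> keep_eq r s.
Proof.
have comm (i j : index_range 1 k) : (val i).+1 < val j ->
    keep_eq (letter i false ++ letter j false) (letter j false ++ letter i false).
  case: i j => [i ix] [j jx] /= ij p _.
  have /andP[i0 ik] := ix; have /andP[j0 jk] := jx; split.
    by apply/funext => x /=; rewrite cross_far.
  rewrite /= !mulg1 kept_gt 1?kept_lt; try lia.
  rewrite !cross_id; try lia.
  have [/andP[pi pi1]|_] := ifP; last by rewrite mul1g mulg1.
  have [/andP[pj pj1]|_] := ifP; last by rewrite mul1g mulg1.
  apply: sigma_comm.
  have ij1 : i.+1 <= j.-1 by lia.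
  have := kept_le p ij1; have := keptS p j.-1.
  by rewrite prednK // pj keptS pi1 /=; lia.
case=> [i j []|i j]; first exact: comm.
  by move=> /comm ji p /ji[-> ->].
case: i j => [i ix] [j jx] /= ij p pm; subst j.
have /andP[i0 ik] := ix; have /andP[j0 jk] := jx.
split; first by apply/funext => x /=; rewrite cross_braid.
rewrite /= !mulg1.
have pm2 : kept p i.+2 <= m by apply: leq_trans (kept_le p jk) pm.
have i_gt : p i -> 0 < kept p i by have := keptS p i.-1; rewrite prednK // => -> ->; lia.
have c1 : cross i i.+2 = i.+2 by rewrite cross_id //; lia.
have c2 : cross i.+1 i = i by rewrite cross_id //; lia.
have k2 : kept (p \o cross i) i.+1 = kept p i.+1 by rewrite kept_gt //; lia.
have k3 : kept ((p \o cross i) \o cross i.+1) i = kept (p \o cross i) i.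
  by rewrite kept_lt.
have k4 : kept (p \o cross i.+1) i = kept p i by rewrite kept_lt.
have k5 : kept ((p \o cross i.+1) \o cross i) i.+1 = kept p i + p i.+2.
  by rewrite kept_gt ?keptS /= ?cross_l ?k4 //; lia.
have := kept_mid p i0; move: pm2 i_gt; rewrite k2 k3 k4 k5 !keptS.
rewrite !(c1, c2, cross_l, cross_r).
case: (p i) (p i.+1) (p i.+2) => [] [] [] /=;
  rewrite ?mul1g ?mulg1 ?addn0 ?addn1 => H1 H2 H3 //;
  rewrite ?H3 //.
- have -> : kept (p \o cross i) i = kept p i by lia.
  by apply: sigma_braid; [exact: H2 | lia].
Qed.

Lemma keep_eq_pres u v : pres_eq (@artin_rel k) u v -> keep_eq u v.
Proof.
elim=> {u v} [u p _ //|u v _ uv p /uv[-> ->]//|v u w _ uv _ vw p pm|u x e v|u r s v rs].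
- by have [-> ->] := uv p pm; exact: vw.
- exact: (@keep_eq_ctx u [:: (x, e); (x, ~~ e)] [::] v (@keep_eq_cancel x e)).
- exact/keep_eq_ctx/keep_eq_artin.
Qed.

Lemma strand_end_pres u v :
  pres_eq (@artin_rel k) u v -> strand_end_word u =1 strand_end_word v.
Proof.
elim=> {u v} [u x //|u v _ uv x|v u w _ uv _ vw x|u [i ik] e v x|u r s v rs x].
- by rewrite uv.
- by rewrite uv vw.
- by rewrite !strand_end_cat /strand_end_word /= crossK.
- rewrite !strand_end_cat; congr strand_end_word.
  move: (strand_end_word u x) => {}x; rewrite /strand_end_word.
  case: rs => [i j ij|i j ij]; rewrite [LHS]/= [RHS]/=.
    by case: ij => ij; have := cross_far x ij.
  by have := cross_braid (val i) x; rewrite -ij.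
Qed.

End WellDefined.

Lemma strand_endE k (w : word (index_range 1 k)) :
  strand_end (wclass (@artin_rel k) w) =1 strand_end_word w.
Proof. exact/strand_end_pres/repr_wclass. Qed.

Lemma kept_init m j : kept (fun x => x <= m) j = minn j m.
Proof. by elim: j => [|j IH]; rewrite ?min0n ?keptS ?IH //; lia. Qed.

Lemma remove_lastE m n (w : word (index_range 1 (m + n))) :
  remove_last (wclass (@artin_rel (m + n)) w)
  = keep_strands_word m (fun x => x <= m) w.
Proof.
have [|_ //] := @keep_eq_pres _ m _ _ (repr_wclass (@artin_rel (m + n)) w)
  (fun x => x <= m).
by rewrite kept_init; lia.
Qed.

Lemma pure_genE k i j : 0 < i < j -> j <= k ->
  pure_gen k i j =
  ((\prod_(t <- rev (index_iota i.+1 j)) sigma k t) * sigma k i ^+ 2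
   * \prod_(i.+1 <= t < j) (sigma k t)^-1)%g.
Proof.
move=> /andP[i0 ij] jk.
have [d dE] : exists d, j = i + d.+1 by exists (j - i.+1); lia.
elim: d i i0 ij dE => [|d IH] i i0 ij dE.
  have -> : j = i.+1 by lia.
  by rewrite /pure_gen /= /index_iota !subnn /= !big_nil !mulg1 !mul1g.
have ij1 : i.+1 < j by lia.
have ij2 : i < j.-1 by lia.
have -> : pure_gen k i j = ((sigma k i)^-1 * pure_gen k i.+1 j * sigma k i)%g.
  rewrite /pure_gen (big_ltn ij2) /index_iota -(subnSK ij2) /= rev_cons.
  by rewrite -cats1 big_cat big_seq1 !mulgA.
rewrite IH //; [|lia].
have -> : (\prod_(t <- rev (index_iota i.+1 j)) sigma k t)%g
    = ((\prod_(t <- rev (index_iota i.+2 j)) sigma k t) * sigma k i.+1)%g.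
  rewrite /index_iota -(subnSK ij1) /= rev_cons.
  by rewrite -cats1 big_cat big_seq1.
rewrite (big_ltn ij1).
have comm t : t \in index_iota i.+2 j -> commute (sigma k i) (sigma k t).
  by rewrite mem_index_iota => /andP[ti _]; apply: sigma_comm.
set V := (\prod_(t <- rev _) _)%g; set W := (\prod_(i.+2 <= t < j) _)%g.
have cV : commute (sigma k i) V.
  rewrite /V big_seq; apply: (big_ind (commute (sigma k i))) => [|x y|t].
  - by rewrite /commute mulg1 mul1g.
  - by move=> cx cy; rewrite /commute mulgA cx -mulgA cy mulgA.
  - by rewrite mem_rev; exact: comm.
have cW : commute (sigma k i) W.
  rewrite /W big_seq; apply: (big_ind (commute (sigma k i))) => [|x y|t].
  - by rewrite /commute mulg1 mul1g.
  - by move=> cx cy; rewrite /commute mulgA cx -mulgA cy mulgA.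
  - by move=> /comm c; exact: commuteV.
have cVV : ((sigma k i)^-1 * V = V * (sigma k i)^-1)%g.
  exact/commute_sym/commuteV/commute_sym.
have b := @sigma_braid k i i0 (leq_trans ij1 jk).
set x := sigma k i in cV cW cVV b *; set y := sigma k i.+1 in b *.
have e : (x^-1 * y * x = y * x * y^-1)%g.
  by apply: (@mulgI _ x); apply: (@mulIg _ y); rewrite !mulgA mulgV mul1g -!mulgA mulVg mulg1 -b.
have e2 : (x^-1 * y ^+ 2 * x = y * x ^+ 2 * y^-1)%g.
  transitivity ((x^-1 * y * x) * (x^-1 * y * x))%g.
    by rewrite expgS expg1 !mulgA mulgK.
  by rewrite e expgS expg1 !mulgA mulgVK.
rewrite -!mulgA -cW !mulgA cVV -!mulgA; congr (_ * _)%g.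
by have := congr1 (fun z => z * W)%g e2; rewrite -!mulgA.
Qed.

(* Main.v *)
(* Conjugation by the generators of B_m acts on the presented group M by the
   Hurwitz moves a_i |-> a_(i+1), a_(i+1) |-> a_(i+1)^-1 a_i a_(i+1). The braids
   of B_(m+n) preserving the set of the first m positions form the
   semidirect product of B_(m,n) and B_m, with one coset for every choice p of m
   positions among 1, ..., m + n. Running Reidemeister-Schreier backwards, a
   letter read in the state p contributes an affine map y |-> c * h(y) of M,
   with c in M and h a power of a Hurwitz move; since the resulting map of a
   word is invariant under the Artin relations, and the word of a generator x of
   M gives y |-> x * y, the map from M to B_(m+n) is injective. Conversely the
   shuffle braids t_p realise the cosets, and t_p w = phi(c) b t_p' where b is
   the braid left from w on the kept strands, so phi is onto the mixed braids. *)
From HB Require Import structures.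
Require Import Defs.
From mathcomp Require Import all_boot.
From mathcomp Require Import boolp classical_sets zify.

Set Implicit Arguments.
Unset Strict Implicit.
Unset Printing Implicit Defensive.

Import Algebra.
Local Open Scope nat_scope.
Local Open Scope group_scope.

(** * Homomorphisms out of a group given by generators and relations *)

Section Lift.
Variables (X : choiceType) (R : word X -> word X -> Prop).
Variables (G : groupType) (f : X -> G).

Definition word_eval (w : word X) : G :=
  \prod_(a <- w) (if a.2 then (f a.1)^-1 else f a.1).

Lemma word_eval_cons x e w :
  word_eval ((x, e) :: w) = (if e then (f x)^-1 else f x) * word_eval w.
Proof. by rewrite /word_eval big_cons. Qed.

Lemma word_eval_letter x e :
  word_eval (letter x e) = if e then (f x)^-1 else f x.
Proof. by rewrite /word_eval big_seq1. Qed.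

Lemma word_eval_cat u v : word_eval (u ++ v) = word_eval u * word_eval v.
Proof. by rewrite /word_eval big_cat. Qed.

Hypothesis fR : forall u v, R u v -> word_eval u = word_eval v.

Lemma word_eval_pres u v : pres_eq R u v -> word_eval u = word_eval v.
Proof.
elim=> {u v} [//|u v _ ->//|v u w _ -> _ -> //|u x e v|u r s v /fR rs].
  rewrite !word_eval_cat !word_eval_cons; congr (_ * _).
  by case: e; rewrite /= ?mulKg ?mulVKg.
by rewrite !word_eval_cat rs.
Qed.

(** The compatibility proof is part of the term, so that a morphism structure can be attached to
    [pres_lift fR]. *)
Definition pres_lift of (forall u v, R u v -> word_eval u = word_eval v) :=
  fun g : pgroup R => word_eval (repr g).

Lemma pres_liftE w : pres_lift fR (wclass R w) = word_eval w.
Proof. exact/word_eval_pres/repr_wclass. Qed.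

Lemma pres_lift_gen x : pres_lift fR (pgen R x) = f x.
Proof. by rewrite pres_liftE word_eval_letter. Qed.

Fact pres_liftM : {morph pres_lift fR : g h / g * h}.
Proof.
move=> g h; rewrite -[g]wclass_repr -[h]wclass_repr -wclass_cat.
by rewrite !pres_liftE word_eval_cat.
Qed.

Fact pres_lift1 : pres_lift fR 1 = 1.
Proof. by rewrite (pres_liftE [::]) /word_eval big_nil. Qed.

End Lift.

HB.instance Definition _ X R (G : groupType) f fR :=
  isUMagmaMorphism.Build (pgroup R) G (@pres_lift X R G f fR)
    (conj (pres_lift1 fR) (pres_liftM fR)).

Lemma hom_wclass (X : choiceType) (R : word X -> word X -> Prop)
    (G : groupType) (F : UMagmaMorphism.type (pgroup R) G) w :
  F (wclass R w) = word_eval (F \o pgen R) w.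
Proof.
elim: w => [|[x e] w IH]; first by rewrite gmulf1 /word_eval big_nil.
rewrite -cat1s wclass_cat gmulfM IH word_eval_cat word_eval_letter; congr (_ * _).
by case: e => //; rewrite -gmulfV -wclass_inv.
Qed.

Lemma hom_ext (X : choiceType) (R : word X -> word X -> Prop) (G : groupType)
    (F F' : UMagmaMorphism.type (pgroup R) G) :
  (forall x, F (pgen R x) = F' (pgen R x)) -> F =1 F'.
Proof.
move=> FF' g; rewrite -[g]wclass_repr !hom_wclass.
by apply: eq_bigr => a _ /=; rewrite FF'.
Qed.

(** * Commutation and conjugation, where [x ^ y] is [y^-1 * x * y] *)

Section Commute.
Variable G : groupType.
Implicit Types x y z g s : G.

Lemma commuteJ x y g : commute x y -> commute (x ^ g) (y ^ g).
Proof. by move=> xy; rewrite /commute -!conjMg xy. Qed.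

Lemma commuteJE x y : commute x y -> x ^ y = x.
Proof. by move=> xy; rewrite conjgE xy mulKg. Qed.

Lemma commuteVl x y : commute x y -> commute x^-1 y.
Proof. by move=> xy; apply/commute_sym/commuteV/commute_sym. Qed.

Lemma commuteJr x y g : commute x y -> commute x g -> commute x (y ^ g).
Proof.
by move=> xy xg; apply: commuteM; [exact: commuteV | exact: commuteM].
Qed.

Lemma commuteJ_inv x y g : commute (x ^ g) (y ^ g) -> commute x y.
Proof. by rewrite /commute -!conjMg => /conjg_inj. Qed.

Lemma braid_conj x y : x * (y * x) = y * (x * y) -> y ^ (x * y) = x.
Proof. by move=> xy; rewrite conjgE -xy (mulgA x) mulKg. Qed.
End Commute.

(** * Sequences of successive conjugates along braid generators, used below both for the moving and
    for the fixed strands *)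

Section Staircase.
Variables (G : groupType) (u : nat -> G) (d : nat).
Hypothesis u_comm : forall k l, 0 < k -> k.+1 < l -> commute (u k) (u l).
Hypothesis u_braid : forall k, 0 < k -> k < d ->
  u k * (u k.+1 * u k) = u k.+1 * (u k * u k.+1).

Section OneFamily.
Variable X : nat -> G.
Hypothesis XS : forall j, X j.+1 = X j ^ u j.+1.
Hypothesis X0_comm : forall k, 1 < k -> commute (X 0) (u k).

Lemma stair_comm_above j k : j.+1 < k -> commute (X j) (u k).
Proof.
elim: j k => [|j IH] k jk; first exact: X0_comm.
rewrite XS; apply/commute_sym/commuteJr; first by apply/commute_sym/IH; lia.
by apply/commute_sym/u_comm.
Qed.

Lemma stair_uJ k : 0 < k -> k < d -> u k ^ (u k.+1 * u k) = u k.+1.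
Proof. by move=> k0 kd; apply: braid_conj; rewrite u_braid. Qed.

(** Together with [stair_uJ]: one conjugation raises the indices of both [X j] and [u j.+1], so
    relations at the bottom propagate upwards. *)
Lemma stairJ j : X j ^ (u j.+2 * u j.+1) = X j.+1.
Proof. by rewrite conjgM (commuteJE (stair_comm_above _)) // XS. Qed.

Lemma stair_comm_below j k : 0 < k < j -> j <= d -> commute (X j) (u k).
Proof.
move=> /andP[k0]; elim: j => [//|j IH] kj jd.
have [jk|jk] := eqVneq j k; last first.
  rewrite XS; apply/commute_sym/commuteJr; first by apply/commute_sym/IH; lia.
  by apply: u_comm => //; lia.
subst j; case: k k0 jd {IH kj} => // k _ kd.
(* [u k.+1] is the conjugate of [u k.+2] by this same element, and [X k] commutes with [u k.+2]. *)
have -> : X k.+2 = X k ^ (u k.+1 * u k.+2) by rewrite XS XS conjgM.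
rewrite -[X in commute _ X](braid_conj (u_braid _ _)) //.
exact/commuteJ/stair_comm_above.
Qed.

Lemma stair_four j : j < d ->
  commute (X 0) (u 1 * (X 0 * u 1)) -> commute (X j) (u j.+1 * (X j * u j.+1)).
Proof.
move=> jd X0; elim: j jd => [//|j IH] jd.
have := commuteJ (u j.+2 * u j.+1) (IH (ltnW jd)).
by rewrite !conjMg stairJ stair_uJ.
Qed.
End OneFamily.

(** The pairs [(j, j.+1)] follow from the pair [(0, 1)] by the index shift; beyond them, each
    further [u] conjugating [Y] commutes with [X j]. *)
Lemma stair_slide X Y :
  (forall j, X j.+1 = X j ^ u j.+1) -> (forall j, Y j.+1 = Y j ^ u j.+1) ->
  (forall k, 1 < k -> commute (X 0%N) (u k)) ->
  (forall k, 1 < k -> commute (Y 0%N) (u k)) ->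
  commute (X 0%N) (Y 1%N) -> forall j l, j < l -> l <= d -> commute (X j) (Y l).
Proof.
move=> XS YS X0 Y0 XY j l jl ld.
elim: l j jl ld => [//|l IH] j; rewrite ltnS leq_eqVlt => /orP[/eqP<- {IH}|jl] ld.
  elim: j {l} ld => [//|j IH] jd.
  have := commuteJ (u j.+2 * u j.+1) (IH (ltnW jd)).
  by rewrite (stairJ XS X0) YS conjJg (stairJ YS Y0) stair_uJ // -YS.
rewrite YS; apply: commuteJr; first by apply: IH; lia.
by apply: (stair_comm_above XS X0).
Qed.
End Staircase.

(* In terms of x2 = x ^ s and y2 = y ^ s, the two relations at a single index
   say that s commutes with x2 x and with y2 y, and the two-index relation that
   y2 commutes with x. *)
Section Hurwitz.
Variables (G : groupType) (s x y : G).

Lemma commute_four z : commute z (s * (z * s)) <-> commute s (z ^ s * z).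
Proof.
rewrite /commute conjgE !mulgA mulgV mul1g.
split=> [h|/(congr1 (fun t => s * t))]; last by rewrite !mulgA mulgV mul1g.
by apply: (@mulgI _ s); rewrite !mulgA mulgV mul1g -h.
Qed.

Hypotheses (hx : commute s (x ^ s * x)) (hy : commute s (y ^ s * y)).
Hypothesis hxy : commute (y ^ s) x.

(** Conjugating [z ^ s * z] by [s^-1] fixes it and turns it into [z * z ^ s^-1]. *)
Lemma conj_sV z : commute s (z ^ s * z) -> z ^ s^-1 = (z ^ s) ^ z.
Proof.
move=> /commuteVl/commute_sym/commuteJE.
rewrite conjMg conjgK => /(canRL (mulKg _)) ->.
by rewrite conjgE.
Qed.

(** Conjugation by [s^-1] turns the claim into the conjugate of [hxy] by [y]. *)
Lemma hurwitz_slide : commute y ((x ^ y) ^ s).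
Proof.
apply: (@commuteJ_inv _ _ _ s^-1); rewrite conjgK conj_sV //.
exact: commuteJ.
Qed.

(** The product is [x ^ s * x] conjugated by [y ^ s * y], and [s] commutes with both. *)
Lemma hurwitz_four : commute s ((x ^ y) ^ s * x ^ y).
Proof.
have -> : (x ^ y) ^ s * x ^ y = (x ^ s * x) ^ (y ^ s * y); last first.
  by apply: commuteJr.
rewrite (conjgM _ (y ^ s) y) [(x ^ s * x) ^ _]conjMg (commuteJE (commute_sym hxy)).
rewrite [RHS]conjMg -conjJg; congr (_ * _); apply/esym/commuteJE.
exact/commute_sym/hurwitz_slide.
Qed.

Lemma hurwitzV_slide : commute (y ^ x^-1) (x ^ s).
Proof.
apply: (@commuteJ_inv _ _ _ x); rewrite conjgKV -conj_sV //.
by apply: (@commuteJ_inv _ _ _ s); rewrite conjgKV.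
Qed.

Lemma hurwitzV_four : commute s ((y ^ x^-1) ^ s * y ^ x^-1).
Proof.
have -> : (y ^ x^-1) ^ s * y ^ x^-1 = (y ^ s * y) ^ (x ^ s * x)^-1; last first.
  by apply: commuteJr => //; apply: commuteV.
rewrite invgM (conjgM _ x^-1) [(y ^ s * y) ^ _]conjMg (commuteJE (commuteV hxy)).
rewrite [RHS]conjMg -conjVg -conjJg; congr (_ * _); apply/esym/commuteJE.
rewrite conjVg; apply: commuteV; exact: hurwitzV_slide.
Qed.
End Hurwitz.

(** * The presented group and the Hurwitz action *)

Section MixedFamily.
Variables m n : nat.

(* The defining relations of the mixed braid group, for families indexed by all
   of nat and with (2') and (3') put in conjugate form. *)
Record mixed_family (G : groupType) (a s : nat -> G) : Prop := MixedFamily {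
  family_far k l : m < k -> k.+1 < l -> l < m + n -> commute (s k) (s l);
  family_braid k : m < k -> k.+1 < m + n ->
    s k * (s k.+1 * s k) = s k.+1 * (s k * s k.+1);
  family_conj i k : 0 < i <= m -> m.+1 < k < m + n -> commute (a i) (s k);
  family_four i : 1 < n -> 0 < i <= m ->
    commute (s m.+1) (a i ^ s m.+1 * a i);
  family_slide r i : 1 < n -> 0 < r -> r < i -> i <= m ->
    commute (a i ^ s m.+1) (a r)
}.

Definition family_gen (G : groupType) (a s : nat -> G) (x : mixed_index m n) :=
  match x with inl i => a (val i) | inr k => s (val k) end.

Lemma family_rel (G : groupType) (a s : nat -> G) : mixed_family a s ->
  forall u v, mixed_rel u v ->
    word_eval (family_gen a s) u = word_eval (family_gen a s) v.
Proof.
case=> far br cj four slide u v.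
(* Every relation with an exponent is a commutation, so the case of exponent -1 follows from that of
   +1. *)
have commS b (x y : G) : commute x y -> commute (if b then x^-1 else x) y.
  by case: b => //; exact: commuteVl.
have far' k l : m < k < m + n -> m < l < m + n -> k.+1 < l \/ l.+1 < k ->
    commute (s k) (s l).
  by move=> ? ? [?|?]; [|apply/commute_sym]; apply: far; lia.
case=> [k l kl|k l kl|i k e k2|i k e k1|i r k e k1 ri];
  rewrite !word_eval_cat !word_eval_letter /=.
- by apply: far' kl; [case: k|case: l].
- rewrite kl; apply: br; case: k l kl => [k ik] [l il] /= kl; lia.
- have ck : commute (a (val i)) (s (val k)).
    by apply: cj; case: i k k2 => [i ii] [k ik] /= k2; lia.
  by have /commuteJE := commS e _ _ ck; rewrite conjgE.
- rewrite k1.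
  suff /commS-/(_ e) -> :
      commute (a (val i)) (s m.+1 * (a (val i) * s m.+1)).
    by rewrite -!mulgA.
  apply/(commute_four (s m.+1)).
  by apply: four; case: i k k1 => [i ii] [k ik] /= k1; lia.
- rewrite k1; apply: commS.
  suff c : commute (a (val i)) (a (val r) ^ (s m.+1)^-1).
    rewrite -[s m.+1 in X in commute _ (X * _)]invgK -conjgE.
    by case: (e) => //; rewrite conjVg; apply: commuteV.
  apply: (@commuteJ_inv _ _ _ (s m.+1)); rewrite conjgKV; apply: slide => //;
    by case: i r k k1 ri => [i ii] [r ir] [k ik] /= k1; lia.
Qed.

Definition mixed_lift (G : groupType) (a s : nat -> G)
    (as_fam : mixed_family a s) :
    UMagmaMorphism.type (pgroup (@mixed_rel m n)) G :=
  pres_lift (family_rel as_fam).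

Local Notation M := (pgroup (@mixed_rel m n)).

(* Total in i and k; the value 1 outside the ranges is junk. *)
Definition mixA (i : nat) : M :=
  if insub i is Some x then pgen (@mixed_rel m n) (inl x) else 1.
Definition mixS (k : nat) : M :=
  if insub k is Some x then pgen (@mixed_rel m n) (inr x) else 1.

Lemma mixA_gen (x : index_range 1 m.+1) : pgen _ (inl x) = mixA (val x).
Proof. by rewrite /mixA valK. Qed.

Lemma mixS_gen (x : index_range m.+1 (m + n)) : pgen _ (inr x) = mixS (val x).
Proof. by rewrite /mixS valK. Qed.

Lemma mixA_junk i : ~~ (0 < i <= m) -> mixA i = 1.
Proof. by move=> h; rewrite /mixA insubN. Qed.

Lemma mixS_junk k : ~~ (m < k < m + n) -> mixS k = 1.
Proof. by move=> h; rewrite /mixS insubN. Qed.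

Lemma mixed_liftA (G : groupType) (a s : nat -> G) (F : mixed_family a s) i :
  0 < i <= m -> mixed_lift F (mixA i) = a i.
Proof.
by move=> h; rewrite /mixA insubT //= pres_lift_gen.
Qed.

Lemma mixed_liftS (G : groupType) (a s : nat -> G) (F : mixed_family a s) k :
  m < k < m + n -> mixed_lift F (mixS k) = s k.
Proof. by move=> h; rewrite /mixS insubT //= pres_lift_gen. Qed.

Lemma mixed_hom_ext (G : groupType) (f g : UMagmaMorphism.type M G) :
  (forall i, 0 < i <= m -> f (mixA i) = g (mixA i)) ->
  (forall k, m < k < m + n -> f (mixS k) = g (mixS k)) -> f =1 g.
Proof.
move=> fgA fgS; apply: hom_ext => -[x|x]; rewrite (mixA_gen, mixS_gen).
  by apply: fgA; case: x.
by apply: fgS; case: x.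
Qed.

Lemma mixS_far k l : k.+1 < l -> commute (mixS k) (mixS l).
Proof.
move=> kl; rewrite /mixS.
case: insubP => [x _ xk|_]; last exact/commute_sym/commute1.
case: insubP => [y _ yl|_]; last exact: commute1.
rewrite /commute -!wclass_cat; apply: wclass_rel.
by apply: mixed_sigma_comm; rewrite xk yl; left.
Qed.

Lemma mixS_braid k : m < k -> k.+1 < m + n ->
  mixS k * (mixS k.+1 * mixS k) = mixS k.+1 * (mixS k * mixS k.+1).
Proof.
move=> mk kn; rewrite /mixS.
case: insubP => [x _ xk|]; last by lia.
case: insubP => [y _ yk|]; last by lia.
rewrite -!wclass_cat; apply: wclass_rel.
by apply: mixed_sigma_braid; rewrite xk yk.
Qed.

Lemma mixA_conj i k : m.+1 < k -> commute (mixA i) (mixS k).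
Proof.
move=> mk; rewrite /mixA; case: insubP => [y _ yi|_]; last exact/commute_sym/commute1.
rewrite /mixS; case: insubP => [x _ xk|_]; last exact: commute1.
have xm : m.+2 <= val x by rewrite xk.
have := wclass_rel (mixed_conj y false xm).
rewrite !wclass_cat -[letter _ true]/(winv (letter (inr x) false)) wclass_inv.
by rewrite -conjgE => h; rewrite /commute conjgC /pgen h.
Qed.

Lemma mixA_four i : commute (mixS m.+1) (mixA i ^ mixS m.+1 * mixA i).
Proof.
apply/commute_four; rewrite /mixA; case: insubP => [y _ yi|_]; last exact/commute_sym/commute1.
rewrite /mixS; case: insubP => [x _ xk|_]; last by rewrite mul1g mulg1; apply: commute_refl.
have h := @mixed_four m n y x false xk.
by rewrite /commute -!mulgA -!wclass_cat; apply: wclass_rel.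
Qed.

Lemma mixA_slide r i : 1 < n -> r < i -> commute (mixA i ^ mixS m.+1) (mixA r).
Proof.
move=> n1 ri; apply: (@commuteJ_inv _ _ _ (mixS m.+1)^-1); rewrite conjgK.
rewrite /mixA; case: insubP => [x _ xi|_]; last exact/commute_sym/commute1.
case: insubP => [y _ yr|_]; last by rewrite conj1g; exact: commute1.
rewrite /mixS; case: insubP => [z _ zm|]; last by lia.
have h : val y < val x by rewrite xi yr.
have := wclass_rel (@mixed_slide m n x y z false zm h).
by rewrite conjgE invgK !wclass_cat -wclass_inv.
Qed.

(* hurwitz i and hurwitzV i are the images of the twists under conjugation by
   sigma_i^-1 and by sigma_i, for i < m. *)
Definition hurwitz (i r : nat) : M :=
  if r == i then mixA i.+1
  else if r == i.+1 then mixA i ^ mixA i.+1 else mixA r.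

Definition hurwitzV (i r : nat) : M :=
  if r == i then mixA i.+1 ^ (mixA i)^-1
  else if r == i.+1 then mixA i else mixA r.

(** The Hurwitz move respects the relations, hence defines an endomorphism. In the slide relation
    only the pair [(i, i.+1)] is delicate: against any other index, [i] and [i.+1] lie on the same
    side. *)
Lemma hurwitz_family i : mixed_family (hurwitz i) mixS.
Proof.
split=> [k l _ kl _|k mk kn|r k _ /andP[mk _]|r n1 _|r t n1 _ rt _].
- exact: mixS_far.
- exact: mixS_braid.
- rewrite /hurwitz; case: eqP => _; last case: eqP => _; try exact: mixA_conj.
  by apply/commute_sym/commuteJr; apply/commute_sym/mixA_conj.
- rewrite /hurwitz; case: eqP => _; last case: eqP => _; try exact: mixA_four.
  by apply: hurwitz_four; by [apply: mixA_four | apply: mixA_slide].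
- rewrite /hurwitz; case: (eqVneq t i) => [ti|ti].
    subst t; rewrite !ifN_eq; try lia.
    by apply: mixA_slide => //; lia.
  case: (eqVneq t i.+1) => [ti1|ti1].
    subst t; case: (eqVneq r i) => [_|ri].
      apply/commute_sym/hurwitz_slide; first exact: mixA_four.
      exact: mixA_slide.
    rewrite ifN_eq; last by lia.
    rewrite conjJg; apply/commute_sym/commuteJr;
      by apply/commute_sym/mixA_slide => //; lia.
  case: (eqVneq r i) => [ri|ri]; first by apply: mixA_slide => //; lia.
  case: (eqVneq r i.+1) => [ri1|ri1]; last by apply: mixA_slide => //; lia.
  by apply: commuteJr; apply: mixA_slide => //; lia.
Qed.

Lemma hurwitzV_family i : mixed_family (hurwitzV i) mixS.
Proof.
split=> [k l _ kl _|k mk kn|r k _ /andP[mk _]|r n1 _|r t n1 _ rt _].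
- exact: mixS_far.
- exact: mixS_braid.
- rewrite /hurwitzV; case: eqP => _; last case: eqP => _; try exact: mixA_conj.
  apply/commute_sym/commuteJr; last apply: commuteV; exact/commute_sym/mixA_conj.
- rewrite /hurwitzV; case: eqP => _; last case: eqP => _; try exact: mixA_four.
  by apply: hurwitzV_four; by [apply: mixA_four | apply: mixA_slide].
- rewrite /hurwitzV; case: (eqVneq t i) => [ti|ti].
    subst t; rewrite !ifN_eq; try lia.
    rewrite conjJg; apply/commute_sym/commuteJr; last rewrite conjVg; last apply: commuteV;
      by apply/commute_sym/mixA_slide => //; lia.
  case: (eqVneq t i.+1) => [ti1|ti1].
    subst t; case: (eqVneq r i) => [_|ri].
      apply/commute_sym/hurwitzV_slide; first exact: mixA_four.
      exact: mixA_slide.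
    rewrite ifN_eq; last by lia.
    by apply: mixA_slide => //; lia.
  case: (eqVneq r i) => [ri|ri].
    apply: commuteJr; last apply: commuteV; apply: mixA_slide => //; lia.
  case: (eqVneq r i.+1) => [ri1|ri1]; by apply: mixA_slide => //; lia.
Qed.

End MixedFamily.

(** * Twists with all moving strands, Hurwitz automorphisms, and the affine maps attached to
    letters *)

Section MixedAction.
Variables m n : nat.
Local Notation M := (pgroup (@mixed_rel m n)).
Local Notation mixA := (mixA m n).
Local Notation mixS := (mixS m n).

(* mixB i j stands for the twist of the i-th fixed strand with the j-th moving
   strand, j counted from 0. *)
Fixpoint mixB (i j : nat) : M :=
  if j is j'.+1 then mixB i j' ^ mixS (m + j) else mixA i.

(** With indices counted from [m], the twists of one fixed strand form a staircase of height
    [n.-1]. *)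
Let u k := mixS (m + k).

Let u_comm k l : 0 < k -> k.+1 < l -> commute (u k) (u l).
Proof. by move=> _ kl; apply: mixS_far; lia. Qed.

Let u_braid k : 0 < k -> k < n.-1 ->
  u k * (u k.+1 * u k) = u k.+1 * (u k * u k.+1).
Proof. by move=> k0 kn; rewrite /u addnS; apply: mixS_braid; lia. Qed.

Let mixB0_comm i k : 1 < k -> commute (mixB i 0) (u k).
Proof. by move=> k1; apply: mixA_conj; lia. Qed.

Lemma mixB_above i j k : j.+1 < k -> commute (mixB i j) (mixS (m + k)).
Proof.
exact: (stair_comm_above u_comm (X := mixB i) (fun=> erefl) (@mixB0_comm i)).
Qed.

Lemma mixB_below i j k : 0 < k < j -> j < n -> commute (mixB i j) (mixS (m + k)).
Proof.
move=> kj jn; apply: (stair_comm_below u_comm u_braid (X := mixB i) (fun=> erefl)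
  (@mixB0_comm i)) => //; lia.
Qed.

Lemma mixB_four i j : j.+1 < n ->
  commute (mixB i j) (mixS (m + j.+1) * (mixB i j * mixS (m + j.+1))).
Proof.
move=> jn; apply: (stair_four u_comm u_braid (X := mixB i) (fun=> erefl)
  (@mixB0_comm i)); first by lia.
by rewrite /u addn1; apply/commute_four/mixA_four.
Qed.

Lemma mixB_slide r i j l : r < i -> j < l -> l < n ->
  commute (mixB r j) (mixB i l).
Proof.
move=> ri jl ln; apply: (stair_slide u_comm u_braid (X := mixB r) (Y := mixB i)
  (fun=> erefl) (fun=> erefl) (@mixB0_comm r) (@mixB0_comm i)) => //; last lia.
by rewrite /= addn1; apply/commute_sym/mixA_slide => //; lia.
Qed.

Definition hur (i : nat) (e : bool) : UMagmaMorphism.type M M := locked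
  (if e then mixed_lift (hurwitzV_family m n i)
   else mixed_lift (hurwitz_family m n i)).

Lemma hurS i e k : hur i e (mixS k) = mixS k.
Proof.
have [km|km] := boolP (m < k < m + n); last first.
  by rewrite mixS_junk // gmulf1.
by rewrite /hur -lock; case: e; exact: mixed_liftS.
Qed.

Lemma hurA i e r : 0 < i < m ->
  hur i e (mixA r) = if e then hurwitzV m n i r else hurwitz m n i r.
Proof.
move=> im; have [rm|rm] := boolP (0 < r <= m).
  by rewrite /hur -lock; case: e; exact: mixed_liftA.
rewrite mixA_junk // gmulf1 /hurwitz /hurwitzV !ifN_eq; try lia.
by rewrite mixA_junk //; case: e.
Qed.

(** Both sides are homomorphisms, so they need only be compared on generators; the same device gives
    [hur_far] and [hur_braid]. *)
Lemma hurK i e : 0 < i < m -> cancel (hur i e) (hur i (~~ e)).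
Proof.
move=> im; apply: (@mixed_hom_ext _ _ _ (hur i (~~ e) \o hur i e) idfun) => [r _|k _];
  last by rewrite /= !hurS.
rewrite /= hurA //; case: e; rewrite /= /hurwitz /hurwitzV;
  (case: (eqVneq r i) => [->|ri]; last case: (eqVneq r i.+1) => [->|ri1]);
  rewrite ?gmulfJ ?gmulfV ?hurA //= /hurwitz /hurwitzV ?eqxx ?ifN_eq; try lia;
  rewrite ?eqxx ?conjgK ?conjgKV //.
Qed.

Lemma hur_mixB_l i j : 0 < i < m -> hur i false (mixB i j) = mixB i.+1 j.
Proof.
move=> im; elim: j => [|j IH] /=; first by rewrite hurA // /hurwitz eqxx.
by rewrite gmulfJ IH hurS.
Qed.

Lemma hur_mixB_r i j : 0 < i < m ->
  hur i false (mixB i.+1 j) = mixB i j ^ mixB i.+1 j.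
Proof.
move=> im; elim: j => [|j IH] /=.
  by rewrite hurA // /hurwitz eqxx ifN_eq //; lia.
by rewrite gmulfJ IH hurS -conjJg.
Qed.

Lemma hur_mixB_id i r j : 0 < i < m -> r != i -> r != i.+1 ->
  hur i false (mixB r j) = mixB r j.
Proof.
move=> im ri ri1; elim: j => [|j IH] /=; first by rewrite hurA // /hurwitz !ifN_eq.
by rewrite gmulfJ IH hurS.
Qed.

Lemma hur_far i k y : 0 < i -> i.+1 < k -> k < m ->
  hur i false (hur k false y) = hur k false (hur i false y).
Proof.
move=> i0 ik km; move: y.
apply: (@mixed_hom_ext _ _ _ (hur i false \o hur k false)
          (hur k false \o hur i false)) => [r _|l _]; last by rewrite /= !hurS.
have ix : 0 < i < m by lia.
have kx : 0 < k < m by lia.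
rewrite /= !hurA //= /hurwitz.
case: (eqVneq r i) => [->|ri]; last case: (eqVneq r i.+1) => [->|ri1];
  last case: (eqVneq r k) => [->|rk]; last case: (eqVneq r k.+1) => [->|rk1];
  rewrite ?ifN_eq ?gmulfJ ?hurA //= /hurwitz ?eqxx ?ifN_eq ?eqxx //; lia.
Qed.

(** The only case that takes an identity is [mixA i.+2], where both sides are [mixA i] conjugated by
    [mixA i.+1 * mixA i.+2]. *)
Lemma hur_braid i y : 0 < i -> i.+1 < m ->
  hur i false (hur i.+1 false (hur i false y))
  = hur i.+1 false (hur i false (hur i.+1 false y)).
Proof.
move=> i0 im; move: y.
apply: (@mixed_hom_ext _ _ _ (hur i false \o (hur i.+1 false \o hur i false))
   (hur i.+1 false \o (hur i false \o hur i.+1 false))) => [r _|l _];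
  last by rewrite /= !hurS.
have ix : 0 < i < m by lia.
have kx : 0 < i.+1 < m by lia.
have E0 k : 0 < k < m -> hur k false (mixA k) = mixA k.+1.
  by move=> ?; rewrite hurA //= /hurwitz eqxx.
have E1 k : 0 < k < m -> hur k false (mixA k.+1) = mixA k ^ mixA k.+1.
  by move=> ?; rewrite hurA //= /hurwitz eqxx ifN_eq //; lia.
have E2 k x : 0 < k < m -> x != k -> x != k.+1 -> hur k false (mixA x) = mixA x.
  by move=> ???; rewrite hurA //= /hurwitz !ifN_eq.
rewrite /=.
have F1 : hur i.+1 false (mixA i) = mixA i by rewrite E2 //; lia.
have F2 : hur i false (mixA i.+2) = mixA i.+2 by rewrite E2 //; lia.
case: (eqVneq r i) => [->|ri]; last case: (eqVneq r i.+1) => [->|ri1];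
  last case: (eqVneq r i.+2) => [->|ri2].
- by rewrite !(E0, F1).
- by rewrite !(E0, E1, F1, F2, gmulfJ).
- rewrite !(E0, E1, F1, F2, gmulfJ) //.
  by rewrite -conjJg.
- by rewrite !E2.
Qed.

(* If t_p is the braid carrying the positions 1, ..., m to the positions kept by
   p (shuffle p 1 (m + n) below) and p' = p \o cross k, then
   t_p sigma_k = letter_coef p k * b * t_p' with b a generator of B_m or 1, and
   letter_act is the conjugation by b. Thus word_map p w is the affine map
   y |-> c * (y conjugated by b), where c and b are the coordinates of
   t_p w in the mixed braids and in B_m. *)
Definition letter_coef (p : pred nat) (k : nat) : M :=
  if p k then 1
  else if p k.+1 then mixB (kept p k).+1 (k.-1 - kept p k)
  else mixS (m + (k - kept p k)).

Definition letter_act (p : pred nat) (k : nat) (e : bool) (y : M) : M :=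
  if p k && p k.+1 then hur (kept p k) e y else y.

(** Coefficient and action are never both nontrivial, so the inverse of an affine map needs no
    action on the inverted coefficient. That coefficient belongs to the positive letter, which
    starts in the state [p \o cross k]. *)
Definition letter_map (p : pred nat) (k : nat) (e : bool) (y : M) : M :=
  if e then (letter_coef (p \o cross k) k)^-1 * letter_act p k true y
  else letter_coef p k * letter_act p k false y.

Fixpoint word_map N (p : pred nat) (w : word (index_range 1 N)) (y : M) : M :=
  if w is (k, e) :: w'
  then letter_map p (val k) e (word_map (p \o cross (val k)) w' y) else y.

Lemma word_map_cat N p (v w : word (index_range 1 N)) y :
  word_map p (v ++ w) y = word_map p v (word_map (keep_after p v) w y).
Proof. by elim: v p => [|[k e] v IH] p //=; rewrite IH. Qed.

Lemma letter_actM p k e : {morph letter_act p k e : x y / x * y}.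
Proof. by move=> x y; rewrite /letter_act; case: ifP => // _; rewrite gmulfM. Qed.

Lemma kept_diff p i j : i <= j -> kept p j <= kept p i + (j - i).
Proof.
elim: j => [|j IH]; first by case: i.
rewrite leq_eqVlt => /orP[/eqP->|ij]; first by lia.
by have := IH ij; rewrite keptS; have := leq_b1 (p j.+1); lia.
Qed.

Lemma kept_bound p i : kept p i <= i.
Proof. by elim: i => // i; rewrite keptS; have := leq_b1 (p i.+1); lia. Qed.

Lemma kept_pred p i : 0 < i -> kept p i = kept p i.-1 + p i.
Proof. by case: i => // i _; rewrite keptS. Qed.

Lemma letter_mapK p k e : 0 < k < m + n -> kept p (m + n) = m ->
  cancel (letter_map (p \o cross k) k (~~ e)) (letter_map p k e).
Proof.
move=> kN pm y; have /andP[k0 kn] := kN.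
have actK : letter_act p k e (letter_act (p \o cross k) k (~~ e) y) = y.
  rewrite /letter_act /= cross_l cross_r [p k.+1 && _]andbC.
  have [/andP[pk pk1]|//] := boolP (p k && p k.+1).
  have := kept_mid p k0; rewrite pk pk1 => /addIn ->.
  have rk : 0 < kept p k < m.
    have := kept_pred p k0; have := kept_le p kn.
    by rewrite pm keptS pk pk1; lia.
  by have := hurK (~~ e) rk y; rewrite negbK.
have coef1 q : q k && q k.+1 -> letter_coef q k = 1.
  by rewrite /letter_coef; case: (q k).
case: e actK => /= actK; rewrite /letter_map ?comp_crossK letter_actM actK.
  have [pk|pk] := boolP (p k && p k.+1).
    rewrite coef1 ?gmulf1 /= ?cross_l ?cross_r 1?andbC //.
    by rewrite /letter_act pk gmulf1 invg1 !mul1g.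
  by rewrite /letter_act (negbTE pk) mulKg.
have [pk|pk] := boolP (p k && p k.+1).
  by rewrite coef1 // /letter_act pk gmulfV gmulf1 invg1 !mul1g.
by rewrite /letter_act (negbTE pk) mulVKg.
Qed.

(** A twist read at [j] belongs to a kept strand whose rank is not one of the two exchanged at [i],
    and the [mixS] are fixed by every Hurwitz move. *)
Lemma letter_act_coef p i j : 0 < i < m + n -> 0 < j < m + n ->
  i.+1 < j \/ j.+1 < i -> kept p (m + n) = m ->
  letter_act p i false (letter_coef p j) = letter_coef p j.
Proof.
move=> iN jN ij pm; rewrite /letter_act /letter_coef.
case: ifP => // /andP[pi pi1].
case: ifP => pj; first exact: gmulf1.
case: ifP => pj1; last exact: hurS.
have hi : kept p i.+1 <= kept p (m + n) by apply: kept_le; lia.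
have hi0 := kept_pred p (proj1 (andP iN)); rewrite keptS pi pi1 pm in hi hi0.
apply: hur_mixB_id; first by lia.
  case: ij => ij.
    by have := kept_le p (ltnW ij); rewrite keptS pi1; lia.
  have /(kept_le p) : j.+1 <= i.-1 by lia.
  by rewrite keptS pj1; lia.
case: ij => ij.
  by have := kept_le p (ltnW ij); rewrite keptS pi1; lia.
have /(kept_le p) : j.+1 <= i.-1 by lia.
by rewrite keptS pj1; lia.
Qed.

Lemma letter_coef_comm p i j : 0 < i -> i.+1 < j -> j < m + n ->
  kept p (m + n) = m -> commute (letter_coef p i) (letter_coef p j).
Proof.
move=> i0 ij jN pm; rewrite /letter_coef.
case: ifP => pi; first exact/commute_sym/commute1.
case: (boolP (p j)) => pj; first exact: commute1.
have bi : kept p i <= i.-1 by rewrite kept_pred // pi addn0 kept_bound.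
have pj' : kept p j = kept p j.-1 by rewrite kept_pred ?(negbTE pj); lia.
have pj1 : kept p j <= kept p i.+1 + (j.-1 - i.+1).
  by rewrite pj'; apply: kept_diff; lia.
have pjl : kept p i.+1 <= kept p j by apply: kept_le; lia.
(* At most [n] of the positions up to [j.+1] are unkept, which keeps the indices of the moving
   strands in range. *)
have pjN : m <= kept p j.+1 + (m + n - j.+1) by rewrite -{1}pm; apply: kept_diff.
rewrite !keptS in pj1 pjl pjN.
case: ifP => pi1; case: ifP => pj2; rewrite pi1 pj2 in pj1 pjl pjN.
- by apply: mixB_slide; lia.
- by apply: mixB_above; lia.
- by apply/commute_sym/mixB_below; lia.
- by apply: mixS_far; lia.
Qed.

Lemma letter_act_far p i j y : 0 < i -> i.+1 < j -> j < m + n ->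
  kept p (m + n) = m ->
  letter_act p i false (letter_act p j false y)
  = letter_act p j false (letter_act p i false y).
Proof.
move=> i0 ij jN pm; rewrite /letter_act.
case: ifP => // /andP[pi pi1]; case: ifP => // /andP[pj pj1].
have := kept_le p jN; rewrite pm keptS pj1 => h1.
have /(kept_le p) : i.+1 <= j.-1 by lia.
have hj := @kept_pred p j; have hi := kept_pred p i0.
rewrite keptS; move: hj hi; rewrite pi pi1 pj => hj hi h2.
by apply: hur_far; lia.
Qed.

End MixedAction.

(** * Rewriting braid words into the presented group *)

Section WordMapInvariance.
Variables m n : nat.
Local Notation letter_map := (@letter_map m n).
Local Notation letter_coef := (@letter_coef m n).
Local Notation letter_act := (@letter_act m n).
Local Notation mixB := (@mixB m n).
Local Notation mixS := (mixS m n).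
Local Notation hur := (@hur m n).

Lemma letter_map_far p i j y : 0 < i -> i.+1 < j -> j < m + n ->
  kept p (m + n) = m ->
  letter_map p i false (letter_map (p \o cross i) j false y)
  = letter_map p j false (letter_map (p \o cross j) i false y).
Proof.
move=> i0 ij jN pm.
have ki : kept (p \o cross i) j = kept p j by rewrite kept_gt //; lia.
have kj : kept (p \o cross j) i = kept p i by rewrite kept_lt //; lia.
have -> z : letter_map (p \o cross i) j false z = letter_map p j false z.
  by rewrite /letter_map /letter_coef /letter_act ki /= !cross_id //; lia.
have -> z : letter_map (p \o cross j) i false z = letter_map p i false z.
  by rewrite /letter_map /letter_coef /letter_act kj /= !cross_id //; lia.
rewrite /letter_map !letter_actM !letter_act_coef //; try lia.
by rewrite !mulgA letter_act_far // (letter_coef_comm i0 ij).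
Qed.

(** Eight cases, by which of the three strands are kept. Three kept strands give the braid relation
    of the Hurwitz moves; two give their values on twists; one gives the recursion of [mixB] or
    [mixB_four]; none gives the braid relation of the [mixS]. *)
Lemma letter_map_braid p i y : 0 < i -> i.+1 < m + n -> kept p (m + n) = m ->
  letter_map p i false (letter_map (p \o cross i) i.+1 false
    (letter_map ((p \o cross i) \o cross i.+1) i false y))
  = letter_map p i.+1 false (letter_map (p \o cross i.+1) i false
    (letter_map ((p \o cross i.+1) \o cross i) i.+1 false y)).
Proof.
move=> i0 iN pm.
have c1 : cross i i.+2 = i.+2 by rewrite cross_id //; lia.
have c2 : cross i.+1 i = i by rewrite cross_id //; lia.
have k2 : kept (p \o cross i) i.+1 = kept p i.+1 by rewrite kept_gt //; lia.
have k3 : kept ((p \o cross i) \o cross i.+1) i = kept (p \o cross i) i.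
  by rewrite kept_lt.
have k4 : kept (p \o cross i.+1) i = kept p i by rewrite kept_lt.
have k5 : kept ((p \o cross i.+1) \o cross i) i.+1 = kept p i + p i.+2.
  by rewrite kept_gt ?keptS /= ?cross_l ?k4 //; lia.
have bi := kept_bound p i.-1.
have bN := kept_le p iN; have dN := kept_diff p iN; rewrite pm !keptS in bN dN.
have := kept_mid p i0.
rewrite /letter_map /letter_coef /letter_act k2 k3 k4 k5 !keptS.
rewrite /= !(c1, c2, cross_l, cross_r).
move: bN dN; rewrite (kept_pred p i0).
set a := kept p i.-1 in bi *.
have [j jE] : exists j, i = (a + j).+1 by exists (i.-1 - a); lia.
have e1 : i.-1 - a = j by lia.
have e2 : i - a.+1 = j by lia.
have e3 : i - a = j.+1 by lia.
have e4 : i.+1 - a.+1 = j.+1 by lia.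
have e5 : i.+1 - a = j.+2 by lia.
case: (p i) (p i.+1) (p i.+2) => [] [] [] /=;
  rewrite ?addn0 ?addn1 => bN dN /eqP; rewrite ?eqn_add2r ?eqSS => /eqP k1;
  rewrite ?k1 ?mul1g ?(e1, e2, e3, e4, e5) //.
- by apply: hur_braid.
- by rewrite gmulfM hur_mixB_l //; lia.
- rewrite !gmulfM hur_mixB_l ?hur_mixB_r; try lia.
  by rewrite [LHS]mulgA [RHS]mulgA -conjgC.
- by rewrite [LHS]mulgA (conjgC _ (mixS _)) -mulgA.
- have jn : j.+1 < n by lia.
  have /commute_four := @mixB_four m n a.+1 j jn; rewrite -[_ ^ _]/(mixB _ j.+1).
  rewrite /commute; move: (mixB a.+1 j.+1) (mixB a.+1 j) => B' B.
  by rewrite !mulgA => ->.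
- rewrite !mulgA; congr (_ * y); rewrite -!mulgA !addnS.
  by apply: mixS_braid; lia.
Qed.

Lemma word_map_artin (v w : word (index_range 1 (m + n))) p
    (y : pgroup (@mixed_rel m n)) : artin_rel v w -> kept p (m + n) = m ->
  word_map p v y = word_map p w y.
Proof.
case=> [[i ix] [j jx] /= ij pm|[i ix] [j jx] /= ij pm].
  case: ij => ij; first by apply: letter_map_far; lia.
  by apply/esym/letter_map_far; lia.
by subst j; apply: letter_map_braid; lia.
Qed.

Lemma word_map_pres (v w : word (index_range 1 (m + n))) p
    (y : pgroup (@mixed_rel m n)) : pres_eq (@artin_rel (m + n)) v w ->
  kept p (m + n) = m -> word_map p v y = word_map p w y.
Proof.
move=> vw; elim: vw p y => {v w} [//|v w _ vw p y pm|u v w _ vu _ uw p y pm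
    |v [k kx] e w p y pm|v r s w rs p y pm].
- by rewrite vw.
- by rewrite vu ?uw.
- rewrite !word_map_cat; congr word_map.
  move: (keep_after p v) (kept_after p v); rewrite pm => q qm /=.
  rewrite comp_crossK; have := @letter_mapK m n q k e; apply=> //.
- have qm : kept (keep_after p v) (m + n) = m by rewrite kept_after.
  rewrite !word_map_cat (word_map_artin _ rs qm) //.
  by have [|-> _] := keep_eq_artin (m := m) rs (p := keep_after p v); rewrite ?qm.
Qed.
End WordMapInvariance.

Lemma keep_after_cat N p (v w : word (index_range 1 N)) :
  keep_after p (v ++ w) = keep_after (keep_after p v) w.
Proof. exact: foldl_cat. Qed.

(** * Braid words for the generators, and the maps they induce *)

Section GeneratorWords.
Variables m n : nat.
Local Notation N := (m + n).
Local Notation M := (pgroup (@mixed_rel m n)).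
Implicit Types v w : word (index_range 1 N).

Let p0 : pred nat := fun x => x <= m.

Let p0m : kept p0 N = m.
Proof. by rewrite kept_init; lia. Qed.

(** The middle two conditions put the braid of [w] in the mixed subgroup; the last recovers [z] from
    [w] and will give injectivity. *)
Definition mixed_word w (z : M) :=
  [/\ keep_after p0 w = p0, keep_strands_word m p0 w = 1,
      forall x, 0 < x <= m -> strand_end_word w x = x
    & forall y, word_map p0 w y = z * y].

Lemma mixed_word_cat v w z t :
  mixed_word v z -> mixed_word w t -> mixed_word (v ++ w) (z * t).
Proof.
move=> [va vk vs vm] [wa wk ws wm]; split.
- by rewrite keep_after_cat va.
- by rewrite keep_strands_cat va vk wk mulg1.
- by move=> x xm; rewrite strand_end_cat vs ?ws.
- by move=> y; rewrite word_map_cat va vm wm mulgA.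
Qed.

(** All four data are invariant under free cancellation, so their values on [winv w] are read off
    from [w ++ winv w]. *)
Lemma mixed_word_inv w z : mixed_word w z -> mixed_word (winv w) z^-1.
Proof.
move=> [wa wk ws wm].
have wV := pres_catV (@artin_rel N) w.
have [|ka kk] := keep_eq_pres (m := m) wV (p := p0); first by rewrite p0m.
split.
- by rewrite -{1}wa -keep_after_cat ka.
- by have := kk; rewrite keep_strands_cat wk wa mul1g.
- by move=> x xm; rewrite -{1}(ws x xm) -strand_end_cat (strand_end_pres wV).
- move=> y; have := word_map_pres y wV p0m.
  by rewrite word_map_cat wa wm /= => h; rewrite -[y in RHS]h mulKg.
Qed.

Definition sigma_word (k : nat) : word (index_range 1 N) :=
  if insub k is Some x then letter x false else [::].

Lemma wclass_sigma_word k : wclass (@artin_rel N) (sigma_word k) = sigma N k.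
Proof. by rewrite /sigma_word /sigma; case: insubP. Qed.

(* The moving strand m + 1 brought leftwards to position m + 1 - d. *)
Fixpoint descent (d : nat) : word (index_range 1 N) :=
  if d is d'.+1 then descent d' ++ sigma_word (m - d') else [::].

Let slot (t : nat) : pred nat := fun x => (x <= m.+1) && (x != t).

(** The state while the moving strand stands at position [t] among the first [m + 1]. *)
Let slot_cross t : 0 < t <= m -> slot t.+1 \o cross t = slot t.
Proof.
move=> tm; apply/funext => x; rewrite /slot /cross /=.
case: (@eqP _ x t) => xt; last case: (@eqP _ x t.+1) => xt1;
  by apply/idP/idP; lia.
Qed.

Let slotm : slot m.+1 = p0.
Proof. by apply/funext => x; rewrite /slot /p0; lia. Qed.

Let sigma_word_step t w : 0 < t < N ->
  exists x : index_range 1 N, val x = t /\ sigma_word t ++ w = (x, false) :: w.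
Proof.
move=> tN; exists (exist _ t tN); split=> //.
by rewrite /sigma_word insubT.
Qed.

(** The left position is kept and the right one is not, so the coefficient is 1: moving leftwards
    contributes nothing. *)
Let slot_step t w y : 0 < t <= m -> 0 < n ->
  [/\ keep_after (slot t.+1) (sigma_word t ++ w) = keep_after (slot t) w,
      keep_strands_word m (slot t.+1) (sigma_word t ++ w)
        = keep_strands_word m (slot t) w
    & word_map (slot t.+1) (sigma_word t ++ w) y = word_map (slot t) w y :> M].
Proof.
move=> tm n0; have tN : 0 < t < N by lia.
have [x [xt ->]] := sigma_word_step w tN.
have sF : slot t.+1 t.+1 = false by rewrite /slot eqxx andbF.
have sT : slot t.+1 t = true by rewrite /slot; lia.
rewrite /keep_after /= xt slot_cross //; split=> //.
  by rewrite sF andbF mul1g.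
by rewrite /letter_map /letter_coef /letter_act sT sF /= mul1g.
Qed.

Let descent_slot d : d <= m -> 0 < n ->
  [/\ keep_after p0 (descent d) = slot (m - d).+1,
      keep_strands_word m p0 (descent d) = 1
    & forall y : M, word_map p0 (descent d) y = y].
Proof.
move=> + n0; elim: d => [|d IH] dm; first by rewrite subn0 slotm.
have [ka kk kw] := IH (ltnW dm).
have tm : 0 < m - d <= m by lia.
have [sa sk _] := slot_step [::] 1 tm n0; rewrite !cats0 in sa sk.
have md : (m - d.+1).+1 = m - d by lia.
split=> [||y] /=; first by rewrite keep_after_cat ka sa md.
  by rewrite keep_strands_cat kk ka sk mulg1.
have [_ _ sw] := slot_step [::] y tm n0; rewrite cats0 in sw.
by rewrite word_map_cat kw ka sw.
Qed.

Definition twist_word (i : nat) : word (index_range 1 N) :=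
  descent (m - i) ++ sigma_word i ++ sigma_word i ++ winv (descent (m - i)).

(** Of the two letters [sigma_i], only the second contributes: there [i.-1] kept positions precede
    the moving strand, so its coefficient is [mixB i 0]. The way back is trivial because the way
    down is. *)
Lemma twist_mixed_word i : 0 < i <= m -> 0 < n ->
  mixed_word (twist_word i) (mixA m n i).
Proof.
move=> im n0; rewrite /twist_word; set V := descent _.
have [va vk vw] : [/\ keep_after p0 V = slot i.+1, keep_strands_word m p0 V = 1
    & forall y : M, word_map p0 V y = y].
  by have [] := @descent_slot (m - i) _ n0; rewrite ?subKn //; lia.
have VV := pres_catV (@artin_rel N) V.
have [|Va Vk] := keep_eq_pres (m := m) VV (p := p0); first by rewrite p0m.
rewrite keep_after_cat va /= in Va; rewrite keep_strands_cat va vk mul1g /= in Vk.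
have Vw (y : M) : word_map (slot i.+1) (winv V) y = y.
  by have := word_map_pres y VV p0m; rewrite word_map_cat va vw.
have iN : 0 < i < N by lia.
have sF : slot i i = false by rewrite /slot eqxx andbF.
have sT : slot i i.+1 = true by rewrite /slot; lia.
have sC : slot i \o cross i = slot i.+1.
  by rewrite -(slot_cross im) comp_crossK.
have [x [xi xE]] := sigma_word_step (winv V) iN.
have [sa sk _] := slot_step (sigma_word i ++ winv V) 1 im n0.
have kept_slot : kept (slot i) i = i.-1.
  rewrite kept_pred ?sF ?addn0; last by lia.
  have : i.-1 < i by lia.
  elim: (i.-1) => // k IH ki; rewrite keptS IH ?[slot i _]/slot; lia.
split.
- by rewrite keep_after_cat va sa xE [LHS]/= xi sC.
- rewrite keep_strands_cat vk va sk xE mul1g /= xi sF /= sC mul1g; exact: Vk.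
- move=> y _; have [z [zi zE]] := sigma_word_step [::] iN.
  rewrite cats0 in zE; rewrite !strand_end_cat zE {2 3}/strand_end_word /= zi crossK.
  by rewrite -strand_end_cat (strand_end_pres VV).
- move=> y; have [_ _ sw] := slot_step (sigma_word i ++ winv V) y im n0.
  rewrite word_map_cat vw va sw xE /= xi sC Vw.
  rewrite /letter_map /letter_coef /letter_act sF sT /= kept_slot prednK ?subnn //.
  by lia.
Qed.

Lemma sigma_mixed_word k : m < k < N -> mixed_word (sigma_word k) (mixS m n k).
Proof.
move=> kN; have kN1 : 0 < k < N by lia.
have [x [xk]] := sigma_word_step [::] kN1; rewrite cats0 => ->.
have pk : p0 k = false by rewrite /p0; lia.
have pk1 : p0 k.+1 = false by rewrite /p0; lia.
have pc : p0 \o cross k = p0.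
  apply/funext => y; rewrite /p0 /cross /=.
  by case: (eqVneq y k) => [->|_]; last case: (eqVneq y k.+1) => [->|//]; lia.
split; rewrite /keep_after /strand_end_word /= ?xk ?pc ?pk ?mulg1 //.
  by move=> y ym; rewrite cross_id //; lia.
move=> y; rewrite /letter_map /letter_coef /letter_act pk pk1 /=.
by rewrite [kept _ _]kept_init (minn_idPr _) ?subnKC //; lia.
Qed.

Lemma wclass_twist_word i : 0 < i <= m -> 0 < n ->
  wclass (@artin_rel N) (twist_word i) = pure_gen N i m.+1.
Proof.
move=> im n0; rewrite pure_genE; try lia.
rewrite /twist_word !wclass_cat wclass_inv wclass_sigma_word.
have -> : wclass (@artin_rel N) (descent (m - i))
    = \prod_(t <- rev (index_iota i.+1 m.+1)) sigma N t.
  have im' : i <= m by lia.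
  have [d dE] : exists d, i + d = m by exists (m - i); lia.
  have -> : m - i = d by lia.
  elim: d i {im im'} dE => [|d IH] i dE.
    by rewrite /index_iota (_ : m.+1 - i.+1 = 0) ?big_nil //; lia.
  have i1m : i.+1 < m.+1 by lia.
  rewrite /index_iota -(subnSK i1m) /= rev_cons -cats1 big_cat big_seq1.
  rewrite wclass_cat (IH i.+1) ?wclass_sigma_word; last by lia.
  by congr (_ * sigma N _); lia.
by rewrite -prodgV expg2 -!mulgA.
Qed.

End GeneratorWords.

(** * The relations in the braid group *)

Section SquareOfBraid.
Variables (G : groupType) (x y : G).
Hypothesis xy : x * (y * x) = y * (x * y).

(** Already [x] commutes with [y * x ^+ 2 * y], by applying the braid relation twice. *)
Lemma braid_sqr_four : commute (x ^+ 2) (y * (x ^+ 2 * y)).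
Proof.
apply/commute_sym/commuteX/commute_sym; rewrite expg2 /commute.
have xyx t : t * x * y * x = t * y * x * y by rewrite -!mulgA xy.
have xyx1 := xyx 1; rewrite !mul1g in xyx1.
by rewrite !mulgA [RHS]xyx xyx1.
Qed.

Lemma braid_sqr_conj : (x ^+ 2) ^ y = (y ^+ 2) ^ x^-1.
Proof.
rewrite !conjXg; congr (_ ^+ 2); apply: (@conjg_inj _ x); rewrite conjgKV.
by rewrite -conjgM; apply: braid_conj.
Qed.

(** The second element is [y ^+ 2] conjugated by [(z * x)^-1], and [x] is [z] conjugated by the same
    element. *)
Lemma braid_sqr_slide z : commute y z -> x * (z * x) = z * (x * z) ->
  commute (x ^+ 2) (((x ^+ 2) ^ y) ^ z^-1).
Proof.
move=> yz xz; rewrite braid_sqr_conj -conjgM -invgM.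
have zx : x = z ^ (z * x)^-1.
  by apply: (@conjg_inj _ (z * x)); rewrite conjgKV braid_conj.
apply/commute_sym/commuteX/commute_sym; rewrite {1}zx.
by apply/commuteJ/commuteX/commute_sym.
Qed.
End SquareOfBraid.

Section PureGen.
Variable N : nat.
Local Notation sg := (sigma N).

Lemma sigma_far i j : i.+1 < j \/ j.+1 < i -> commute (sg i) (sg j).
Proof. by case=> h; [|apply/commute_sym]; apply: sigma_comm. Qed.

Lemma sigma0 : sg 0 = 1.
Proof. by rewrite /sigma insubN. Qed.

Lemma pure_genS i j : i.+1 < j -> pure_gen N i j = pure_gen N i.+1 j ^ sg i.
Proof.
move=> ij; have ij1 : i < j.-1 by lia.
rewrite /pure_gen (big_ltn ij1) /index_iota -(subnSK ij1) /= rev_cons.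
by rewrite -cats1 big_cat big_seq1 conjgE !mulgA.
Qed.

Lemma pure_gen_adj i : pure_gen N i i.+1 = sg i ^+ 2.
Proof.
by rewrite /pure_gen /= big_geq // /index_iota subnn big_nil mulg1 mul1g.
Qed.

End PureGen.

Section BraidFamily.
Variables m N : nat.
Hypothesis mN : m < N.
Local Notation sg := (sigma N).
Let a i := pure_gen N i m.+1.
(** A second staircase, descending from [m]. Truncated subtraction together with [sigma0] makes it
    constant from [j = m] on. *)
Let u k := sg (m - k).
Let X j := a (m - j).

Let u_comm k l : 0 < k -> k.+1 < l -> commute (u k) (u l).
Proof.
move=> k0 kl; rewrite /u; have [lm|lm] := leqP l m.
  by apply: sigma_far; lia.
by rewrite (_ : m - l = 0) ?sigma0; [exact: commute1|lia].
Qed.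

Let u_braid k : 0 < k -> k < m.-1 ->
  u k * (u k.+1 * u k) = u k.+1 * (u k * u k.+1).
Proof.
move=> k0 km; rewrite /u; have -> : m - k = (m - k.+1).+1 by lia.
by apply/esym/sigma_braid; lia.
Qed.

Let XS j : X j.+1 = X j ^ u j.+1.
Proof.
rewrite /X /u /a; have [jm|jm] := leqP m j.
  have [-> ->] : m - j.+1 = 0 /\ m - j = 0 by lia.
  by rewrite sigma0 conjg1.
by rewrite pure_genS; [congr (pure_gen _ _ _ ^ _)|]; lia.
Qed.

Let X0 : X 0 = sg m ^+ 2.
Proof. by rewrite /X /a subn0 pure_gen_adj. Qed.

Let X0_comm k : 1 < k -> commute (X 0) (u k).
Proof.
move=> k1; rewrite X0; apply/commute_sym/commuteX.
rewrite /u; have [mk|mk] := leqP m k; last by apply: sigma_far; lia.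
by have -> : m - k = 0 by [lia]; rewrite sigma0; exact/commute_sym/commute1.
Qed.

Lemma pure_gen_far i k : 0 < i <= m -> 0 < k < m -> k != i -> k.+1 != i ->
  commute (a i) (sg k).
Proof.
move=> im km ki ki1.
have -> : a i = X (m - i) by rewrite /X; congr a; lia.
have -> : sg k = u (m - k) by rewrite /u; congr sg; lia.
have [ik|ik] := ltnP i k.
  by apply: (stair_comm_below u_comm u_braid XS X0_comm); lia.
by apply: (stair_comm_above u_comm XS X0_comm); lia.
Qed.

Let braid_pred : 1 < m ->
  sg m * (sg m.-1 * sg m) = sg m.-1 * (sg m * sg m.-1).
Proof.
by move=> m1; have := @sigma_braid N m.-1; rewrite prednK => [->|] //; lia.
Qed.

Lemma pure_gen_four i : 0 < i < m ->
  commute (a i.+1) (sg i * (a i.+1 * sg i)).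
Proof.
move=> im; have iE : (m - i.+1).+1 = m - i by lia.
have := @stair_four _ _ _ u_comm u_braid X XS X0_comm (m - i.+1).
rewrite /X /u iE !subKn; try lia; apply; first by lia.
rewrite subn0 /a pure_gen_adj; apply: braid_sqr_four.
by rewrite subn1; apply: braid_pred; lia.
Qed.

(** Since [a i] is [a i.+1] conjugated by [sigma_i], this is [pure_gen_four] in disguise; it makes
    the Hurwitz move a conjugation in the braid group. *)
Lemma pure_gen_hurwitz i : 0 < i < m ->
  a i ^ a i.+1 = a i.+1 ^ (sg i)^-1.
Proof.
move=> im; apply: (@conjg_inj _ (sg i)); rewrite conjgKV.
rewrite {1}/a pure_genS; last by lia.
rewrite -!conjgM; exact/commuteJE/pure_gen_four.
Qed.

Lemma braid_family n : 0 < m -> N = m + n -> mixed_family m n a sg.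
Proof.
move=> m0 NE; split=> [k l mk kl _|k mk kN|i k im kN|i n1 im|r i n1 r0 ri im].
- by apply: sigma_far; left.
- by apply: sigma_braid; lia.
- have -> : a i = X (m - i) by rewrite /X; congr a; lia.
  elim: (m - i) => [|j IH]; first by rewrite X0; apply/commute_sym/commuteX/sigma_far; lia.
  rewrite XS; apply/commute_sym/commuteJr; first exact/commute_sym.
  by rewrite /u; apply: sigma_far; lia.
- have -> : a i = X (m - i) by rewrite /X; congr a; lia.
  apply/commute_four; elim: (m - i) => [|j IH].
    by rewrite X0; apply: braid_sqr_four; apply: sigma_braid; lia.
  have su : commute (sg m.+1) (u j.+1) by rewrite /u; apply: sigma_far; lia.
  have := commuteJ (u j.+1) IH.
  by rewrite (conjMg (sg m.+1)) (conjMg (X j)) -XS (commuteJE su).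
- have aX k : k <= m -> a k = X (m - k) by move=> km; rewrite /X; congr a; lia.
  apply: (@commuteJ_inv _ _ _ (sg m.+1)^-1); rewrite conjgK !aX; try lia.
  have su k : 0 < k -> commute (u k) (sg m.+1)^-1.
    by move=> k0; apply: commuteV; rewrite /u; apply: sigma_far; lia.
  (* The second staircase is the first one conjugated by [sigma_(m+1)^-1], which commutes with every
     [u k] for [k > 0]. *)
  apply: (stair_slide u_comm u_braid (X := X)
    (Y := fun j => X j ^ (sg m.+1)^-1)) => //; try lia.
  + by move=> j /=; rewrite XS -[LHS]conjgM -[RHS]conjgM su.
  + move=> k k1; apply/commute_sym/commuteJr; last by apply: su; lia.
    exact/commute_sym/X0_comm.
  + rewrite XS X0 /u subn1; apply: braid_sqr_slide.
    * by apply: braid_pred; lia.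
    * by apply: sigma_far; lia.
    * by apply: sigma_braid; lia.
Qed.

End BraidFamily.

(** * Shuffle braids *)

Section Shuffle.
Variable N : nat.
Local Notation sg := (sigma N).
Local Notation cnt p o l := (count p (iota o l)).

(** The product [sigma_(o+q-1) ... sigma_o]: the strand at [o + q] moves left to [o], past [q]
    strands. *)
Fixpoint desc (o q : nat) : braid N :=
  if q is q'.+1 then sg (o + q') * desc o q' else 1.

Lemma descE o q : desc o q = \prod_(t <- rev (iota o q)) sg t.
Proof.
elim: q => [|q IH]; first by rewrite big_nil.
by rewrite -[in RHS]addn1 iotaD rev_cat big_cat /= IH big_seq1.
Qed.

Lemma desc_recr o q : desc o q.+1 = desc o.+1 q * sg o.
Proof.
elim: q => [|q IH]; first by rewrite /= addn0 mulg1 mul1g.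
by rewrite -[LHS]/(sg (o + q.+1) * desc o q.+1) IH mulgA addnS.
Qed.

Lemma desc_far o q k : k.+1 < o \/ o + q < k -> commute (sg k) (desc o q).
Proof.
elim: q => [|q IH] kq; first exact: commute1.
apply: commuteM; last by apply: IH; lia.
by case: kq => ?; [|apply/commute_sym]; apply: sigma_comm; lia.
Qed.

Lemma desc_shift o q t : 0 < o -> o + q <= N -> o <= t -> t.+1 < o + q ->
  desc o q * sg t.+1 = sg t * desc o q.
Proof.
move=> o0; elim: q => [|q IH] qN ot tq; first by lia.
have [tq'|tq'] := eqVneq t.+1 (o + q); last first.
  rewrite /= -mulgA IH; try lia.
  by rewrite !mulgA; congr (_ * _); apply/esym/sigma_comm; lia.
case: q IH tq' qN tq => [|q] IH tq' qN tq; first by lia.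
have -> : t = o + q by lia.
rewrite /= addnS -!mulgA -desc_far; last by right; lia.
by rewrite !mulgA; congr (_ * _); rewrite -!mulgA; apply/esym/sigma_braid; lia.
Qed.

Lemma desc_desc o q r : 0 < o -> o + q < N -> r <= q ->
  desc o q.+1 * desc o.+1 r = desc o r * desc o q.+1.
Proof.
move=> o0 qN; elim: r => [|r IH] rq; first by rewrite mulg1 mul1g.
rewrite -[desc o.+1 r.+1]/(sg (o.+1 + r) * desc o.+1 r) addSn mulgA desc_shift; try lia.
by rewrite -mulgA IH ?mulgA //; lia.
Qed.

(* The braid sending the positions 1, ..., q to the positions kept by p among
   o, ..., o + l - 1, in order: the unkept strands are pulled to their places
   one after the other, leftmost first. *)
Fixpoint shuffle (p : pred nat) (o l : nat) : braid N :=
  if l is l'.+1 then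
    if p o then shuffle p o.+1 l'
    else desc o (cnt p o.+1 l') * shuffle p o.+1 l'
  else 1.

Lemma shuffle_far p o l k : k.+1 < o -> commute (sg k) (shuffle p o l).
Proof.
elim: l o => [|l IH] o ko; first exact: commute1.
rewrite /=; case: ifP => _; first by apply: IH; lia.
by apply: commuteM; [apply: desc_far; left | apply: IH; lia].
Qed.

Lemma eq_shuffle p q o l : (forall x, o <= x < o + l -> p x = q x) ->
  shuffle p o l = shuffle q o l.
Proof.
elim: l o => [//|l IH] o pq /=; rewrite pq; last by lia.
rewrite (@IH o.+1); last by move=> x xl; apply: pq; lia.
rewrite (@eq_in_count _ p q) // => x; rewrite mem_iota => xl.
by apply: pq; lia.
Qed.

Lemma shuffle_init m o l : shuffle (fun x => x <= m) o l = 1.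
Proof.
elim: l o => [//|l IH] o /=; rewrite IH; case: ifP => // om.
rewrite (@eq_in_count _ _ pred0) ?count_pred0 ?mulg1 // => x.
by rewrite mem_iota => xl; apply/negbTE; lia.
Qed.

Lemma cnt_cat p o d l : d <= l -> cnt p o l = cnt p o d + cnt p (o + d) (l - d).
Proof. by move=> dl; rewrite -count_cat -iotaD subnKC. Qed.

Lemma cnt_le p o l : cnt p o l <= l.
Proof. by rewrite -[X in _ <= X](size_iota o l) count_size. Qed.

Lemma cnt_cross p o l d : 0 < o -> d.+1 < l ->
  cnt (p \o cross (o + d)) o l = cnt p o l.
Proof.
move=> o0 dl.
have E q : kept q (o.-1 + l) = kept q o.-1 + cnt q o l.
  by rewrite /kept iotaD count_cat add1n prednK.
have := E p; have := E (p \o cross (o + d)).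
have -> : kept (p \o cross (o + d)) (o.-1 + l) = kept p (o.-1 + l).
  by apply: kept_gt; lia.
have -> : kept (p \o cross (o + d)) o.-1 = kept p o.-1 by apply: kept_lt; lia.
by move=> -> /addnI.
Qed.

Lemma cnt_pair (p : pred nat) o l d : d.+1 < l ->
  cnt p o d + (p (o + d) + p (o + d).+1) <= cnt p o l.
Proof.
move=> dl; rewrite (@cnt_cat p o d l); last by lia.
have -> : l - d = (l - d.+2).+2 by lia.
by rewrite /=; lia.
Qed.

(** Two adjacent kept positions come from adjacent strands; every unkept position to their left
    shifts the index by one, by [desc_shift]. *)
Lemma shuffle_kept (p : pred nat) o l d : 0 < o -> o + l <= N.+1 -> d.+1 < l ->
  p (o + d) -> p (o + d).+1 ->
  shuffle p o l * sg (o + d) = sg (o + cnt p o d) * shuffle p o l.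
Proof.
elim: l o d => [//|l IH] o [|d] o0 lN dl.
  case: l dl {IH} lN => // l _ lN; rewrite addn0 /= => -> ->.
  by rewrite ?addn0; apply/esym/shuffle_far; lia.
rewrite -addSnnS => pd pd1; rewrite /=.
have IH' := IH o.+1 d isT _ _ pd pd1.
case: ifP => po; first by rewrite IH'; [congr (sg _ * _)|..]; lia.
rewrite -mulgA IH'; try lia.
have /(cnt_pair p o.+1) : d.+1 < l by lia.
rewrite pd pd1 => cl; have := cnt_le p o.+1 l => cl'.
by rewrite mulgA addSn desc_shift ?mulgA ?(ifF _ _ po) //; lia.
Qed.

(** Before the shuffle an unkept strand lies behind all [cnt p o l] kept ones and behind the
    [d - cnt p o d] unkept ones to its left. *)
Lemma shuffle_unkept (p : pred nat) o l d : 0 < o -> o + l <= N.+1 -> d.+1 < l ->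
  ~~ p (o + d) -> ~~ p (o + d).+1 ->
  shuffle p o l * sg (o + d)
  = sg (o + cnt p o l + (d - cnt p o d)) * shuffle p o l.
Proof.
elim: l o d => [//|l IH] o [|d] o0 lN dl.
  case: l dl {IH} lN => // l _ lN; rewrite addn0 /= => /negbTE-> /negbTE->.
  rewrite subnn !add0n addn0 -!mulgA -shuffle_far; last by lia.
  have cl := cnt_le p o.+2 l.
  set q := cnt _ _ _ in cl *.
  rewrite (mulgA _ (sg o)) -desc_recr mulgA -(@desc_desc o q q); try lia.
  by rewrite -!mulgA.
rewrite -addSnnS => pd pd1; rewrite /=.
have IH' := IH o.+1 d isT _ _ pd pd1; have cd := cnt_le p o.+1 d.
case: ifP => po; first by rewrite IH'; [congr (sg _ * _)|..]; lia.
rewrite -mulgA IH'; try lia.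
rewrite !mulgA -desc_far; last by right; lia.
by congr (sg _ * _ * _); lia.
Qed.

(** At the leftmost position the crossing becomes the last letter of the [desc] in the new
    shuffle. *)
Lemma shuffle_cross (p : pred nat) o l d : 0 < o -> o + l <= N.+1 -> d.+1 < l ->
  p (o + d) -> ~~ p (o + d).+1 ->
  shuffle p o l * sg (o + d) = shuffle (p \o cross (o + d)) o l.
Proof.
elim: l o d => [//|l IH] o [|d] o0 lN dl.
  case: l dl {IH} lN => // l _ lN; rewrite addn0 /= => po /negbTE po1.
  rewrite cross_l cross_r po po1 -mulgA -shuffle_far; last by lia.
  rewrite mulgA -desc_recr add1n.
  rewrite (@eq_in_count _ (p \o cross o) p); last first.
    by move=> x; rewrite mem_iota => xl /=; rewrite cross_id //; lia.
  congr (_ * _); apply: eq_shuffle => x xl /=.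
  by rewrite cross_id //; lia.
rewrite -addSnnS => pd pd1; rewrite /= cnt_cross //.
rewrite -IH // ?cross_id; try lia.
by case: ifP => // _; rewrite mulgA.
Qed.

Fixpoint twist (a c j : nat) : braid N :=
  if j is j'.+1 then twist a c j' ^ sg (c + j') else pure_gen N a c.

Lemma desc_pure_gen o a c : 0 < o -> o <= a -> a < c -> c < N ->
  pure_gen N a.+1 c.+1 ^ (desc o (c - o).+1)^-1 = pure_gen N a c.
Proof.
move=> o0 oa ac cN; set E := desc _ _.
have shift t : o <= t -> t < c -> sg t.+1 ^ E^-1 = sg t.
  move=> ot tc; rewrite conjgE invgK mulgA /E desc_shift; try lia.
  by rewrite mulgK.
have [d dE] : exists d, c = a + d.+1 by exists (c - a.+1); lia.
elim: d a oa ac dE => [|d IH] a oa ac dE.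
  have -> : c = a.+1 by lia.
  by rewrite !pure_gen_adj conjXg shift.
rewrite (@pure_genS _ a c) ?(@pure_genS _ a.+1 c.+1); try lia.
by rewrite conjJg shift ?IH //; lia.
Qed.

(** This [desc] lacks the first letter [sigma_c] of the one in [desc_pure_gen]; the missing letter
    is the extra conjugation that raises [j]. *)
Lemma desc_twist o a c j : 0 < o -> o <= a -> a < c -> c < N ->
  desc o (c - o) * twist a.+1 c.+1 j = twist a c j.+1 * desc o (c - o).
Proof.
move=> o0 oa ac cN; set D := desc _ _.
suff <- : twist a.+1 c.+1 j ^ D^-1 = twist a c j.+1 by rewrite -conjgCV.
elim: j => [|j IH].
  rewrite /= addn0 -(desc_pure_gen o0 oa ac cN) -conjgM.
  by rewrite /= subnKC ?invgM ?mulgVK //; lia.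
rewrite -[twist a c j.+2]/(twist a c j.+1 ^ sg (c + j.+1)) -IH.
rewrite -[twist a.+1 c.+1 j.+1]/(twist a.+1 c.+1 j ^ sg (c.+1 + j)).
rewrite addSnnS -!conjgM; congr (_ ^ _).
by apply: commuteV; apply: desc_far; right; lia.
Qed.

(** At the leftmost position this is the second expression of [pure_gen]; further left, an unkept
    position raises the twist index by [desc_twist]. *)
Lemma shuffle_sqr (p : pred nat) o l d :
  0 < o -> o + l <= N.+1 -> d.+1 < l -> p (o + d) -> ~~ p (o + d).+1 ->
  shuffle p o l * sg (o + d) ^+ 2
  = twist (o + cnt p o d) (o + cnt p o l) (d - cnt p o d) * shuffle p o l.
Proof.
elim: l o d => [//|l IH] o [|d] o0 lN dl.
  case: l dl {IH} lN => // l _ lN; rewrite addn0 /= => po /negbTE po1.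
  rewrite po po1 ?addn0 add0n add1n addnS.
  set q := cnt p o.+2 l; have ql : q <= l := cnt_le p o.+2 l.
  rewrite -mulgA (commuteX 2 (commute_sym (shuffle_far p l (ltnSn o.+1)))) mulgA.
  rewrite pure_genE; try lia.
  rewrite descE /index_iota (_ : (o + q).+1 - o.+1 = q); last by lia.
  by rewrite prodgV -!mulgA mulKg.
rewrite -addSnnS => pd pd1; rewrite /=.
have IH' := IH o.+1 d isT _ _ pd pd1; have cd := cnt_le p o.+1 d.
case: ifP => po.
  by rewrite IH' ?add1n ?subSS ?addSnnS //; lia.
have dl' : d.+1 < l by lia.
(* Counting the complement as well shows that some position is unkept, whence [o + q < N] below. *)
have := @cnt_pair p o.+1 l d dl'; have /= := @cnt_pair (predC p) o.+1 l d dl'.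
rewrite pd1 pd /=; have := count_predC p (iota o.+1 l); rewrite size_iota.
move=> cl cC cp.
set c := cnt p o.+1 d in cd cp IH' *; set q := cnt p o.+1 l in cl cp IH' *.
have ql : o + q < N by lia.
have oq : o + q - o = q by lia.
rewrite -mulgA IH'; try lia.
have := @desc_twist o (o + c) (o + q) (d - c); rewrite oq => dt.
rewrite !addSn mulgA dt; try lia.
by rewrite subSn // mulgA.
Qed.

End Shuffle.

Lemma comp_cross_same (p : pred nat) k : p k = p k.+1 -> p \o cross k = p.
Proof.
move=> pk; apply/funext => x /=; rewrite /cross.
by case: (eqVneq x k) => [->|_] //; case: (eqVneq x k.+1) => [->|//].
Qed.

Lemma keep_after_strand_end N (p : pred nat) (w : word (index_range 1 N)) x :
  keep_after p w (strand_end_word w x) = p x.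
Proof.
elim: w p x => [//|[k e] w IH] p x /=.
by rewrite /strand_end_word /= -/(strand_end_word w _) IH /= crossK.
Qed.

Section InnerAutomorphism.
Variables (G : groupType) (g : G).

Definition inner_aut (x : G) : G := x ^ g.

Fact inner_aut_morphism : monoid_morphism inner_aut.
Proof. by split=> [|x y]; rewrite /inner_aut ?conj1g ?conjMg. Qed.

HB.instance Definition _ :=
  isUMagmaMorphism.Build G G inner_aut inner_aut_morphism.
End InnerAutomorphism.

(** * The homomorphism to the braid group: coset formula, injectivity and image *)

Section Realization.
Variables m n : nat.
Hypotheses (m0 : 0 < m) (n0 : 0 < n).
Local Notation N := (m + n).
Local Notation sg := (sigma N).
Local Notation M := (pgroup (@mixed_rel m n)).

Let mN : m < N. Proof. by lia. Qed.

Definition mixed_phi : UMagmaMorphism.type M (braid N) :=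
  locked (mixed_lift (braid_family mN m0 (erefl N))).

Lemma phiA i : 0 < i <= m -> mixed_phi (mixA m n i) = pure_gen N i m.+1.
Proof. by move=> im; rewrite /mixed_phi -lock mixed_liftA. Qed.

Lemma phiS k : m < k < N -> mixed_phi (mixS m n k) = sg k.
Proof. by move=> kN; rewrite /mixed_phi -lock mixed_liftS. Qed.

Lemma phi_mixB i j : 0 < i <= m -> j < n ->
  mixed_phi (mixB m n i j) = twist N i m.+1 j.
Proof.
move=> im; elim: j => [|j IH] jn; first exact: phiA.
by rewrite /= gmulfJ IH ?phiS ?addnS //; lia.
Qed.

Lemma phi_hur i y : 0 < i < m ->
  mixed_phi (hur m n i false y) = mixed_phi y ^ (sg i)^-1.
Proof.
move=> im.
have [i0 iN] : 0 < i /\ i < N by lia.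
move: y; apply: (@mixed_hom_ext _ _ _ (mixed_phi \o hur m n i false)
  (inner_aut (sg i)^-1 \o mixed_phi)) => [r rm|k kN];
  rewrite /= /inner_aut; last first.
  rewrite hurS phiS //; apply/esym/commuteJE/commuteV/sigma_far; lia.
rewrite hurA //= /hurwitz.
case: (eqVneq r i) => [->|ri]; first by rewrite !phiA ?(@pure_genS _ i) ?conjgK //; lia.
case: (eqVneq r i.+1) => [->|ri1].
  by rewrite gmulfJ !phiA ?pure_gen_hurwitz //; lia.
rewrite phiA //; apply/esym/commuteJE/commuteV.
by apply: pure_gen_far; rewrite // eq_sym.
Qed.

Lemma shuffle_letter p k : kept p N = m -> 0 < k < N ->
  shuffle N p 1 N * sg k
  = mixed_phi (letter_coef m n p k) * (if p k && p k.+1 then sg (kept p k) else 1)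
    * shuffle N (p \o cross k) 1 N.
Proof.
move=> pm kN; have [d dE] : exists d, k = 1 + d by exists k.-1; lia.
have dN : d.+1 < N by lia.
have k0 : 0 < k by lia.
have kd : count p (iota 1 d) = kept p k.-1 by rewrite dE.
have kp := kept_pred p k0.
have kb := kept_bound p k.-1.
have kdf : m <= kept p k.+1 + (N - k.+1) by rewrite -{1}pm; apply: kept_diff; lia.
have kle : kept p k.+1 <= kept p N by apply: kept_le; lia.
rewrite pm in kle; rewrite keptS in kdf kle; rewrite /letter_coef.
have [pk|pk] := boolP (p k); have [pk1|pk1] := boolP (p k.+1); rewrite /=.
- rewrite gmulf1 mul1g comp_cross_same ?pk ?pk1 // dE shuffle_kept -?dE // kd.
  by congr (sg _ * _); rewrite pk in kp; lia.
- by rewrite gmulf1 !mul1g dE shuffle_cross -?dE.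
(* As [t_q sigma_k = t_p] by [shuffle_cross], the product [t_p sigma_k] is [t_q sigma_k^2], which
   [shuffle_sqr] evaluates. *)
- pose q := p \o cross k.
  have qk : q k by rewrite /q /= cross_l.
  have qk1 : ~~ q k.+1 by rewrite /q /= cross_r.
  have kq : kept q k = (kept p k).+1.
    by have := kept_mid p k0; rewrite (negbTE pk) pk1 -/q; lia.
  have qm : count q (iota 1 N) = m by rewrite -[LHS]/(kept q N) kept_gt.
  have kqd : count q (iota 1 d) = kept p k.
    have := kept_pred q k0; rewrite qk kq -[count _ _]/(kept q d).
    by have -> : k.-1 = d by [lia]; rewrite addn1 => -[].
  have qx : q \o cross (1 + d) = p by rewrite -dE /q comp_crossK.
  have := @shuffle_cross N q 1 N d isT (leqnn _) dN.
  rewrite qx -dE => <- //; rewrite -mulgA.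
  have := @shuffle_sqr N q 1 N d isT (leqnn _) dN.
  rewrite -dE expg2 => -> //; rewrite kqd qm !add1n mulg1.
  rewrite (negbTE pk) in kp; rewrite pk1 in kle kdf.
  have -> : k.-1 = d by lia.
  by rewrite phi_mixB //; lia.
- rewrite mulg1 comp_cross_same ?(negbTE pk) ?(negbTE pk1) //.
  rewrite (negbTE pk) in kp; rewrite (negbTE pk1) in kle kdf.
  have -> : sg k = sg (1 + d) by rewrite dE.
  rewrite shuffle_unkept -?dE // kd phiS; last by lia.
  by rewrite -[count p _]/(kept p N) pm; congr (sg _ * _); lia.
Qed.

Lemma artin_rel_sigma u v : @artin_rel m u v ->
  word_eval (fun x : index_range 1 m => sg (val x)) u
  = word_eval (fun x : index_range 1 m => sg (val x)) v.
Proof.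
case=> [i j ij|i j ij]; rewrite !word_eval_cat !word_eval_letter /=.
  exact: sigma_far.
by rewrite ij; apply: sigma_braid; case: i j ij => [i ix] [j jx] /= ij; lia.
Qed.

Definition braid_incl : UMagmaMorphism.type (braid m) (braid N) :=
  locked (pres_lift artin_rel_sigma :
    UMagmaMorphism.type (pgroup (@artin_rel m)) (braid N)).

Lemma braid_incl_sigma i : 0 < i < m -> braid_incl (sigma m i) = sg i.
Proof.
move=> im; rewrite /braid_incl -lock /sigma insubT.
exact: (pres_lift_gen artin_rel_sigma).
Qed.

Let kept_rank p k : kept p N = m -> 0 < k < N -> p k && p k.+1 ->
  0 < kept p k < m.
Proof.
move=> pm kN /andP[pk pk1]; have k0 : 0 < k by lia.
have := kept_pred p k0; have : kept p k.+1 <= kept p N by apply: kept_le; lia.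
by rewrite pm keptS pk pk1; lia.
Qed.

(** The coset formula, by induction on the word: each letter splits by [shuffle_letter], and its
    factor from the first [m] strands passes [mixed_phi] by [phi_hur]. *)
Lemma shuffle_word p (w : word (index_range 1 N)) : kept p N = m ->
  shuffle N p 1 N * wclass (@artin_rel N) w
  = mixed_phi (word_map p w 1) * braid_incl (keep_strands_word m p w)
    * shuffle N (keep_after p w) 1 N.
Proof.
elim: w p => [|[[k kN] e] w IH] p pm /=.
  by rewrite !gmulf1 !mul1g mulg1.
have pm' : kept (p \o cross k) N = m by rewrite kept_gt //; lia.
rewrite -cat1s wclass_cat.
have -> : wclass (@artin_rel N) [:: (exist _ k kN, e)]
    = if e then (sg k)^-1 else sg k.
  have E : wclass (@artin_rel N) (letter (exist _ k kN) false) = sg k.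
    by rewrite /sigma insubT.
  by case: e; rewrite -?E // -wclass_inv.
set b := if p k && p k.+1 then _ else _.
pose s := if p k && p k.+1 then sg (kept p k) else 1.
have step : shuffle N p 1 N * (if e then (sg k)^-1 else sg k)
    = mixed_phi (if e then (letter_coef m n (p \o cross k) k)^-1
                 else letter_coef m n p k)
      * (if e then s^-1 else s) * shuffle N (p \o cross k) 1 N.
  case: (e); last exact: shuffle_letter.
  (* A negative letter is handled by inverting the formula for the positive letter leading back to
     [p]. *)
  have := shuffle_letter pm' kN; rewrite comp_crossK /= cross_l cross_r.
  rewrite [p k.+1 && _]andbC /s gmulfV; case: ifP => pk.
    have -> : letter_coef m n (p \o cross k) k = 1.
      by rewrite /letter_coef /= cross_l; case/andP: pk => _ ->.
    rewrite gmulf1 invg1 !mul1g comp_cross_same; last by case/andP: pk => -> ->.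
    by move=> h; apply: (@mulIg _ (sg k)); rewrite mulgVK -mulgA h mulKg.
  rewrite invg1 !mulg1 => h; apply: (@mulIg _ (sg k)).
  by rewrite mulgVK -mulgA h mulKg.
have act y : (if e then s^-1 else s) * mixed_phi y
    = mixed_phi (letter_act p k e y) * (if e then s^-1 else s).
  rewrite /letter_act /s; have [pk|pk] := boolP (p k && p k.+1); last first.
    by case: (e); rewrite ?invg1 mul1g mulg1.
  have rk := kept_rank pm kN pk.
  case: (e); last by rewrite phi_hur // conjgE invgK -mulgA mulgVK.
  have {1}-> : y = hur m n (kept p k) false (hur m n (kept p k) true y).
    by have := hurK true rk y; rewrite /= => ->.
  by rewrite phi_hur // conjgE invgK !mulgA mulVg mul1g.
have incl : braid_incl b = if e then s^-1 else s.
  rewrite /b /s; have [pk|pk] := boolP (p k && p k.+1); last first.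
    by case: (e); rewrite ?invg1 gmulf1.
  by have rk := kept_rank pm kN pk; case: (e); rewrite ?gmulfV braid_incl_sigma.
rewrite mulgA step -mulgA IH // gmulfM incl !mulgA; congr (_ * _ * _).
rewrite -(mulgA _ _ (mixed_phi _)) act mulgA; congr (_ * _).
by rewrite /letter_map; case: (e); rewrite gmulfM.
Qed.

Lemma mixed_word_phi (z : M) : exists w,
  mixed_phi z = wclass (@artin_rel N) w /\ mixed_word w z.
Proof.
rewrite -[z]wclass_repr; elim: (repr z) => [|[x e] u [w [wE ww]]].
  exists [::]; split; first exact: gmulf1.
  by split=> // y; rewrite [wclass _ _]/(1 : M) mul1g.
have [v [vE vv]] : exists v, mixed_phi (pgen _ x) = wclass (@artin_rel N) v
    /\ mixed_word v (pgen _ x).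
  case: x => [[i im]|[k kN]].
    exists (twist_word m n i); rewrite mixA_gen phiA // wclass_twist_word //.
    by split=> //; apply: twist_mixed_word.
  exists (sigma_word m n k); rewrite mixS_gen phiS // wclass_sigma_word.
  by split=> //; apply: sigma_mixed_word.
exists ((if e then winv v else v) ++ w); rewrite -cat1s !wclass_cat gmulfM wE.
have -> : wclass (@mixed_rel m n) [:: (x, e)]
    = if e then (pgen _ x)^-1 else pgen _ x.
  by case: (e) => //; rewrite -wclass_inv.
split.
  by case: (e); rewrite ?gmulfV vE ?wclass_inv.
by apply: mixed_word_cat => //; case: (e) => //; exact: mixed_word_inv.
Qed.

(** A word for [mixed_phi z] induces multiplication by [z]. If its braid is trivial the map is the
    identity, and evaluating at 1 gives [z = 1]. *)
Lemma mixed_phi_inj : injective mixed_phi.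
Proof.
apply: gmulf_inj => z.
have [w [-> [_ _ _ wm]]] := mixed_word_phi z.
move=> /wclassP wE; have := word_map_pres (1 : M) wE.
move=> /(_ (fun x => x <= m)); rewrite wm mulg1 /=; apply.
by rewrite kept_init; lia.
Qed.

Lemma range_mixed_phi : range mixed_phi = mixed_braid m n.
Proof.
apply/seteqP; split=> [_ [z _ <-]|b [bs br]].
  have [w [-> [_ wk ws _]]] := mixed_word_phi z.
  by split=> [x xm|]; rewrite ?strand_endE ?remove_lastE ?ws.
pose w := repr b; pose p0 : pred nat := fun x => x <= m.
have wE : wclass (@artin_rel N) w = b := wclass_repr b.
have pm : kept p0 N = m by rewrite kept_init; lia.
pose p1 := keep_after p0 w.
have p1l x : 0 < x <= m -> p1 x.
  move=> xm; have := keep_after_strand_end p0 w x.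
  by rewrite -[strand_end_word w x]/(strand_end b x) bs // -/p1 => ->; case/andP: xm.
have p1m : kept p1 m = m.
  suff h j : j <= m -> kept p1 j = j by exact: h.
  by elim: j => // j IH jm; rewrite keptS p1l // IH; lia.
(* The first [m] positions already exhaust the [m] kept ones. *)
have p1r x : m < x -> x <= N -> p1 x = false.
  move=> mx xN; apply/negbTE/negP => px; have x0 : 0 < x by lia.
  have h1 : kept p1 x <= m by rewrite -pm -(kept_after p0 w); apply: kept_le.
  have h2 : kept p1 m <= kept p1 x.-1 by apply: kept_le; lia.
  by have := kept_pred p1 x0; rewrite px; lia.
(* The initial and final shuffles are both trivial and so is the kept braid, leaving [b] as a value
   of [mixed_phi]. *)
have := shuffle_word w pm; rewrite shuffle_init mul1g wE.
rewrite [keep_strands_word _ _ _]br gmulf1 mulg1 -/p1.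
rewrite (@eq_shuffle _ _ p0) ?shuffle_init ?mulg1; last first.
  move=> x xN; rewrite /p0; have [xm|xm] := leqP x m; first by rewrite p1l //; lia.
  by rewrite p1r //; lia.
by move=> ->; exists (word_map p0 w 1).
Qed.
End Realization.

Theorem theorem3 (m n : nat) (hm : 1 <= m) (hn : 1 <= n) :
  has_presentation (mixed_braid m n) (@mixed_gen m n) (@mixed_rel m n).
Proof.
exists (mixed_phi hm hn); split=> [[[i im]|[k kN]]||].
- by rewrite mixA_gen phiA.
- by rewrite mixS_gen phiS.
- exact: mixed_phi_inj.
- exact: range_mixed_phi.
Qed.
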